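(* Consider the problem of learning the support $S^0$ of the row $A^0_r$ of $A^0\in\mathbb{R}^{p\times p}$ from the discrete-time trajectory $\{x(t)\}_{0\le t\le n}$ of the stationary process $x(t)=x(t-1)+\eta A^0x(t-1)+w(t)$, with $\eta>0$. Assume $|S^0|\le k$, $C_{\min}>0$, $\alpha>0$ and $D>0$ (these quantities, and $A_{\min}$, are defined in the context), and let $\delta\in(0,1)$. If $$n\eta>\frac{10^4\,k^2\,(kD^{-2}+A_{\min}^{-2})}{\alpha^2\,D\,C_{\min}^2}\,\log\Big(\frac{4pk}{\delta}\Big),$$ then there exists $\lambda$ such that $\ell_1$-regularized least squares (with regularization parameter $\lambda$) recovers the signed support of $A^0_r$ with probability larger than $1-\delta$. This is achieved by taking $$\lambda=\sqrt{\frac{36\,\log(4p/\delta)}{D\,\alpha^2\,n\eta}}.$$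
   Context: Model: $\eta>0$, $A^0\in\mathbb{R}^{p\times p}$, and $x(t)=x(t-1)+\eta A^0x(t-1)+w(t)$, where the $w(t)$ are i.i.d. centered Gaussian vectors in $\mathbb{R}^p$ with covariance $\eta I_{p\times p}$. Let $\sigma_{\max}=\sigma_{\max}(I+\eta A^0)$ be the largest singular value of $I+\eta A^0$ and $D=(1-\sigma_{\max})/\eta$; it is assumed that $D>0$. The process is started in its stationary state: $x(0)$ is independent of $\{w(t)\}_{t\ge1}$ and is centered Gaussian with covariance $Q^0$ solving $A^0Q^0+Q^0(A^0)^*+\eta A^0Q^0(A^0)^*+I=0$. $M^*$ denotes the transpose. Fix $r\in[p]=\{1,\dots,p\}$. $A^0_r\in\mathbb{R}^p$ denotes the $r$-th row of $A^0$ (viewed as a vector), $S^0\subseteq[p]$ its support, $(S^0)^C=[p]\setminus S^0$, and $A_{\min}$ the smallest absolute value among the non-zero entries of $A^0_r$. The signed support of a vector $v$ is $\mathrm{sign}(v)$, taken entrywise with $\mathrm{sign}(0)=0$. $\ell_1$-regularized least squares with parameter $\lambda$: the estimate of $A^0_r$ is the solution of the convex problem of minimizing over $A_r\in\mathbb{R}^p$ the function $L(A_r)+\lambda\|A_r\|_1$, where $$L(A_r)=\frac{1}{2\eta^2n}\sum_{t=0}^{n-1}\big\{x_r(t+1)-x_r(t)-\eta A_r^*x(t)\big\}^2.$$ It recovers the signed support of $A^0_r$ if the solution $\hat A_r$ satisfies $\mathrm{sign}(\hat A_r)=\mathrm{sign}(A^0_r)$. Parameters: $M_{L,R}=(M_{ij})_{i\in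 L,j\in R}$ denotes a submatrix; $|||M|||_\infty=\max_i\sum_j|M_{ij}|$ is the operator sup norm. $C_{\min}=\lambda_{\min}(Q^0_{S^0,S^0})$ (smallest eigenvalue); $\alpha$ is defined by $|||Q^0_{(S^0)^C,S^0}(Q^0_{S^0,S^0})^{-1}|||_\infty=1-\alpha$. *)

(* Defs.v *)
From HB Require Import structures.
From mathcomp Require Import all_boot all_order all_algebra finmap.
From mathcomp Require Import all_classical all_reals all_analysis.

Set Implicit Arguments.
Unset Strict Implicit.
Unset Printing Implicit Defensive.

Import Order.TTheory GRing.Theory Num.Theory.

Local Open Scope classical_set_scope.
Local Open Scope ring_scope.

Section LinearAlgebra.
Context {R : realType}.

Definition spectrum (m : nat) (M : 'M[R]_m) : set R :=
  [set a | eigenvalue M a].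

(* lambda_min is used for symmetric M, and both definitions for positive m; the
   sets involved are then finite and nonempty, so that inf and sup are the
   smallest eigenvalue and the largest singular value. *)
Definition lambda_min (m : nat) (M : 'M[R]_m) : R := inf (spectrum M).

Definition sigma_max (m : nat) (M : 'M[R]_m) : R :=
  sup [set Num.sqrt a | a in spectrum (M^T *m M)].

Definition submatrix (m n : nat) (M : 'M[R]_(m, n))
    (I : {set 'I_m}) (J : {set 'I_n}) : 'M[R]_(#|I|, #|J|) :=
  mxsub (fun i : 'I_#|I| => enum_val i) (fun j : 'I_#|J| => enum_val j) M.

Definition op_norm_infty (m n : nat) (M : 'M[R]_(m, n)) : R :=
  \big[Order.max/0]_(i < m) \sum_(j < n) `|M i j|.

Definition norm1 (m : nat) (v : 'cV[R]_m) : R := \sum_(i < m) `|v i 0|.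

Definition dotv (m : nat) (u v : 'cV[R]_m) : R := (u^T *m v) 0 0.

Definition signv (m : nat) (v : 'cV[R]_m) : 'cV[R]_m := map_mx Num.sg v.

Definition supp (m : nat) (v : 'cV[R]_m) : {set 'I_m} :=
  finset (fun i => v i 0 != 0).

Definition min_abs_nonzero (m : nat) (v : 'cV[R]_m) : R :=
  inf [set `|v i 0| | i in [set i : 'I_m | v i 0 != 0]].

End LinearAlgebra.

Section Probability.
Context {d : measure_display} {T : measurableType d} {R : realType}.
Variable P : probability T R.

(* The library's normal_prob 0 0 is the uniform law on [0, 1], not the point
   mass, hence the case distinction. *)
Definition centered_normal (v : R) (B : set R) : \bar R :=
  if v == 0 then \d_(0 : R) B else normal_prob 0 (Num.sqrt v) B.

Definition centered_gaussian_vector (m : nat) (X : T -> 'cV[R]_m)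
    (Q : 'M[R]_m) : Prop :=
  [/\ forall i, measurable_fun setT (fun omega => X omega i 0),
      Q^T = Q,
      forall u : 'cV[R]_m, 0 <= dotv u (Q *m u) &
      forall (u : 'cV[R]_m) (B : set R), measurable B ->
        P ((fun omega => dotv u (X omega)) @^-1` B) =
        centered_normal (dotv u (Q *m u)) B].

Definition sigma_generated (I : Type) (m : nat) (X : I -> T -> 'cV[R]_m) :
    set (set T) :=
  <<s [set E | exists i j B, measurable B /\
         E = (fun omega => X i omega j 0) @^-1` B] >>.

Definition mutually_independent (m : nat) (X : nat -> T -> 'cV[R]_m) : Prop :=
  forall (J : {fset nat}) (E : nat -> set T),
    (forall t, t \in J -> sigma_generated (fun _ : unit => X t) (E t)) ->
    P (\bigcap_(t in [set` J]) E t) = (\prod_(t <- J) P (E t))%E.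

Definition independent_of_family (m : nat) (Y : T -> 'cV[R]_m)
    (X : nat -> T -> 'cV[R]_m) : Prop :=
  forall E F : set T,
    sigma_generated (fun _ : unit => Y) E -> sigma_generated X F ->
    P (E `&` F) = (P E * P F)%E.

(* An event E of which measurability has not been established is said to have
   probability larger than c when it contains a measurable event that does;
   for measurable E this is c < P E. *)
Definition probability_larger_than (E : set T) (c : R) : Prop :=
  exists F : set T, [/\ measurable F, F `<=` E & (c%:E < P F)%E].

Record stationary_process (p : nat) (eta : R) (A Q : 'M[R]_p)
    (x w : nat -> T -> 'cV[R]_p) : Prop := StationaryProcess {
  recursion : forall t omega,
    x t.+1 omega = x t omega + eta *: (A *m x t omega) + w t.+1 omega ;
  noise_gaussian : forall t, centered_gaussian_vector (w t.+1) (eta *: 1%:M) ;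
  noise_independent : mutually_independent (fun t => w t.+1) ;
  stationary_covariance :
    A *m Q + Q *m A^T + eta *: (A *m Q *m A^T) + 1%:M = 0 ;
  initial_gaussian : centered_gaussian_vector (x 0) Q ;
  initial_independent : independent_of_family (x 0) (fun t => w t.+1)
}.

End Probability.

Section Lasso.
Context {R : realType}.
Variables (p : nat) (eta : R).

Definition drift_row (A : 'M[R]_p) (r : 'I_p) : 'cV[R]_p := (row r A)^T.

Definition contraction_rate (A : 'M[R]_p) : R :=
  (1 - sigma_max (1%:M + eta *: A)) / eta.

Definition Cmin (Q : 'M[R]_p) (S : {set 'I_p}) : R :=
  lambda_min (submatrix Q S S).

Definition incoherence (Q : 'M[R]_p) (S : {set 'I_p}) : R :=
  1 - op_norm_infty (submatrix Q (~: S) S *m invmx (submatrix Q S S)).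

Definition least_squares_loss (n : nat) (x : nat -> 'cV[R]_p) (r : 'I_p)
    (a : 'cV[R]_p) : R :=
  (2 * eta ^+ 2 * n%:R)^-1 *
  \sum_(0 <= t < n) (x t.+1 r 0 - x t r 0 - eta * dotv a (x t)) ^+ 2.

Definition lasso_cost (n : nat) (x : nat -> 'cV[R]_p) (r : 'I_p) (lambda : R)
    (a : 'cV[R]_p) : R :=
  least_squares_loss n x r a + lambda * norm1 a.

Definition lasso_solutions (n : nat) (x : nat -> 'cV[R]_p) (r : 'I_p)
    (lambda : R) : set 'cV[R]_p :=
  [set a | forall b, lasso_cost n x r lambda a <= lasso_cost n x r lambda b].

(* The minimizer exists, is unique, and has the right signs. *)
Definition recovers_signed_support (n : nat) (x : nat -> 'cV[R]_p) (r : 'I_p)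
    (lambda : R) (a0 : 'cV[R]_p) : Prop :=
  exists a, lasso_solutions n x r lambda = [set a] /\ signv a = signv a0.

End Lasso.

(* Main.v *)
Require Import Defs.
From HB Require Import structures.
From mathcomp Require Import all_boot all_order all_algebra finmap.
From mathcomp Require Import all_classical all_reals all_analysis.
From mathcomp Require Import measurable_realfun ring lra.

Set Implicit Arguments.
Unset Strict Implicit.
Unset Printing Implicit Defensive.

Import Order.TTheory GRing.Theory Num.Theory.
Import numFieldNormedType.Exports.

Local Open Scope classical_set_scope.
Local Open Scope ring_scope.

(** The proof separates a deterministic analysis of the lasso from the
  concentration of two random quantities: the empirical covariance [H] of the
  states and the correlation [G] of the noise with the states.

  In terms of [H] and [G] the least squares loss is a quadratic function, and the
  minimizer is found by solving the problem restricted to the support with the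
  signs of the true row. If [H] is entrywise within [eps] of the stationary
  covariance on the columns of the support, with [7 k eps <= alpha C], and if the
  entries of [G] are at most [lambda alpha / 3], this candidate satisfies the
  optimality conditions strictly, and has the right signs as soon as [lambda] is
  small against [C Amin / k] ([lasso_sign_consistency]).

  For [H], polarization leaves the sums of the squares of [dotv u (x t)]. Their
  exponential moments are computed backwards in time. Averaging over one Gaussian
  noise vector turns the exponential of a quadratic form of the next state into the
  exponential of a slightly inflated form of the current state
  ([gaussian_step_expR_wform]). In this step the square of the noise is handled by
  the convexity of the exponential, which sees only the trace of the form, so no
  dimension appears. The forms that occur are weighted sums of squares along the
  orbit of [u] under the transpose of the transition matrix, and the stationarity
  equation says that the traces of these forms add up to the variance of
  [dotv u (x t)], up to the inflation. As the inflation is proportional to the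
  parameter [s] of the exponential, the logarithm of the moment exceeds its linear
  part by order [n s ^+ 2 / (eta D ^+ 3)] only ([square_sum_mgf]), and Markov's
  inequality gives the tail bound ([square_sum_dev]).

  For [G], the exponential martingale of the noise compares each entry with the sum
  of the squares of a coordinate of the states, which the previous bound controls
  ([noise_correlation_tail]).

  Both arguments hold the past fixed while the next noise vector is averaged
  ([expectation_freeze_past_le]); this rests on the independence of the two
  generated sigma-algebras ([independent_past]). The spectral hypotheses enter
  through Rayleigh quotients ([lambda_min_le], [sigma_max_ge]), which make the
  transition a contraction and bound the covariance by [D^-1] ([covariance_le]).

  With [eps = alpha C / (7 k)] the assumption on the sample size makes each event
  about [H] fail with probability at most the square of [delta / (4 p k)], while the
  value of [lambda] makes each event about [G] fail with probability at most
  [delta / (4 p)]; a union bound concludes ([failure_budget]). *)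

(** * Euclidean linear algebra *)

Section DotProduct.
Context {R : realType}.

Lemma dotvE m (u v : 'cV[R]_m) : dotv u v = \sum_i u i 0 * v i 0.
Proof. by rewrite /dotv mxE; apply: eq_bigr => i _; rewrite mxE. Qed.

Lemma dotvC m (u v : 'cV[R]_m) : dotv u v = dotv v u.
Proof. by rewrite !dotvE; apply: eq_bigr => i _; rewrite mulrC. Qed.

Lemma dotvDr m (u v w : 'cV[R]_m) : dotv u (v + w) = dotv u v + dotv u w.
Proof. by rewrite /dotv mulmxDr mxE. Qed.

Lemma dotvDl m (u v w : 'cV[R]_m) : dotv (u + v) w = dotv u w + dotv v w.
Proof. by rewrite dotvC dotvDr !(dotvC w). Qed.

Lemma dotvZr m a (u v : 'cV[R]_m) : dotv u (a *: v) = a * dotv u v.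
Proof. by rewrite /dotv -scalemxAr mxE. Qed.

Lemma dotvZl m a (u v : 'cV[R]_m) : dotv (a *: u) v = a * dotv u v.
Proof. by rewrite dotvC dotvZr dotvC. Qed.

Lemma dotvNr m (u v : 'cV[R]_m) : dotv u (- v) = - dotv u v.
Proof. by rewrite -scaleN1r dotvZr mulN1r. Qed.

Lemma dotvNl m (u v : 'cV[R]_m) : dotv (- u) v = - dotv u v.
Proof. by rewrite dotvC dotvNr dotvC. Qed.

Lemma dotvBr m (u v w : 'cV[R]_m) : dotv u (v - w) = dotv u v - dotv u w.
Proof. by rewrite dotvDr dotvNr. Qed.

Lemma dotvBl m (u v w : 'cV[R]_m) : dotv (u - v) w = dotv u w - dotv v w.
Proof. by rewrite dotvDl dotvNl. Qed.

Lemma dotv0r m (u : 'cV[R]_m) : dotv u 0 = 0.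
Proof. by rewrite /dotv mulmx0 mxE. Qed.

Lemma dotv0l m (u : 'cV[R]_m) : dotv 0 u = 0.
Proof. by rewrite dotvC dotv0r. Qed.

Lemma dotv_sumr m I r (P : pred I) (u : 'cV[R]_m) (F : I -> 'cV[R]_m) :
  dotv u (\sum_(i <- r | P i) F i) = \sum_(i <- r | P i) dotv u (F i).
Proof. by rewrite /dotv mulmx_sumr summxE. Qed.

Lemma dotv_suml m I r (P : pred I) (u : 'cV[R]_m) (F : I -> 'cV[R]_m) :
  dotv (\sum_(i <- r | P i) F i) u = \sum_(i <- r | P i) dotv (F i) u.
Proof. by rewrite dotvC dotv_sumr; apply: eq_bigr => i _; rewrite dotvC. Qed.

Lemma dotv_ge0 m (u : 'cV[R]_m) : 0 <= dotv u u.
Proof. by rewrite dotvE sumr_ge0// => i _; rewrite -expr2 sqr_ge0. Qed.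

Lemma dotv_eq0 m (u : 'cV[R]_m) : dotv u u = 0 -> u = 0.
Proof.
rewrite dotvE => /eqP; rewrite psumr_eq0 => [/allP u0|i _]; last first.
  by rewrite -expr2 sqr_ge0.
apply/colP => i; rewrite mxE; apply/eqP.
by have := u0 i (mem_index_enum _); rewrite /= mulf_eq0 orbb.
Qed.

Lemma dotv_gt0 m (u : 'cV[R]_m) : u != 0 -> 0 < dotv u u.
Proof.
by move=> u0; rewrite lt0r dotv_ge0 andbT; apply: contraNneq u0 => /dotv_eq0 ->.
Qed.

Lemma dotv_mulmx m n (M : 'M[R]_(m, n)) u v :
  dotv u (M *m v) = dotv (M^T *m u) v.
Proof. by rewrite /dotv trmx_mul trmxK mulmxA. Qed.

Lemma dotv_delta m (i : 'I_m) (v : 'cV[R]_m) : dotv (delta_mx i 0) v = v i 0.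
Proof. by rewrite /dotv trmx_delta -rowE mxE. Qed.

Lemma dotv_delta2 m (i : 'I_m) : dotv (delta_mx i 0) (delta_mx i 0) = 1 :> R.
Proof. by rewrite dotv_delta mxE !eqxx. Qed.

Lemma cauchy_schwarz_dotv m (u v : 'cV[R]_m) :
  dotv u v ^+ 2 <= dotv u u * dotv v v.
Proof.
have [->|u0] := eqVneq u 0; first by rewrite !dotv0l expr0n mul0r.
have uu := dotv_gt0 u0.
have := dotv_ge0 (dotv u u *: v - dotv u v *: u).
rewrite !(dotvBl, dotvBr, dotvZl, dotvZr) (dotvC v u) => h.
rewrite -subr_ge0 -(pmulr_rge0 _ uu).
by apply: le_trans h _; rewrite le_eqVlt; apply/orP; left; apply/eqP; ring.
Qed.

End DotProduct.

Section Rayleigh.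
Context {R : realType}.

Lemma continuous_sum (T : topologicalType) I (r : seq I) (f : I -> T -> R) :
  (forall i, continuous (f i)) -> continuous (fun t => \sum_(i <- r) f i t).
Proof.
move=> cf; elim: r => [|i r IHr] t.
  by under eq_fun do rewrite big_nil; exact: cvg_cst.
under eq_fun do rewrite big_cons; apply: cvgD; [exact: cf|exact: IHr].
Qed.

Lemma continuous_quadratic_form m (M : 'M[R]_m) :
  continuous (fun t : 'rV[R]_m => dotv t^T (M *m t^T)).
Proof.
have -> : (fun t : 'rV[R]_m => dotv t^T (M *m t^T)) =
    (fun t : 'rV[R]_m => \sum_i \sum_j t ord0 i * M i j * t ord0 j).
  apply/funext => t; rewrite dotvE; apply: eq_bigr => i _.
  rewrite mxE mxE mulr_sumr; apply: eq_bigr => j _.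
  by rewrite mxE mulrA.
apply: continuous_sum => i; apply: continuous_sum => j t.
apply: (@continuousM R _ (fun t : 'rV[R]_m => t ord0 i * M i j)
  (fun t : 'rV[R]_m => t ord0 j)); last exact: coord_continuous.
apply: (@continuousM R _ (fun t : 'rV[R]_m => t ord0 i) (fun=> M i j)).
  exact: coord_continuous.
exact: cst_continuous.
Qed.

(** Moving from [v] a little against the gradient [B *m v] would otherwise make
  the form negative. *)
Lemma psd_kernel m (B : 'M[R]_m) (v : 'cV[R]_m) : B^T = B ->
  (forall x, 0 <= dotv x (B *m x)) -> dotv v (B *m v) = 0 -> B *m v = 0.
Proof.
move=> Bsym Bpos v0; set z := B *m v.
apply: dotv_eq0; apply/eqP; rewrite eq_le dotv_ge0 andbT leNgt.
apply/negP => zz; set c := dotv z z in zz *; set e := dotv z (B *m z).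
have e0 : 0 <= e by exact: Bpos.
have e1 : 0 < e + 1 by rewrite ltr_wpDl.
pose t := c / (e + 1).
have := Bpos (v - t *: z).
rewrite mulmxBr -scalemxAr !(dotvBl, dotvBr, dotvZl, dotvZr) v0.
rewrite (_ : dotv v (B *m z) = c); last by rewrite dotv_mulmx Bsym.
rewrite -/z -/c -/e => h.
have t0 : 0 < t by rewrite divr_gt0.
have tE : t * (e + 1) = c by rewrite divfK// gt_eqF.
have tt : 0 < t * t by rewrite mulr_gt0.
have tc : 0 < t * c by rewrite mulr_gt0.
have : t * t * (e + 1) = t * c by rewrite -mulrA tE.
lra.
Qed.

(** The form attains its minimum [a] on the compact unit sphere. Then [M - a%:M] is
  positive semidefinite and vanishes at the minimizer, which is therefore an
  eigenvector. *)
Lemma rayleigh_min m (M : 'M[R]_m) : (0 < m)%N -> M^T = M ->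
  exists a v, [/\ dotv v v = 1, M *m v = a *: v &
    forall x, a * dotv x x <= dotv x (M *m x)].
Proof.
case: m M => // m M _ Msym.
pose S : set 'rV[R]_m.+1 := [set t | dotv t^T t^T = 1].
have S0 : S !=set0.
  by exists (delta_mx 0 0); rewrite /S /= trmx_delta dotv_delta2.
have cS : compact S.
  apply: bounded_closed_compact.
    exists 1; split => // x x1 t St; apply: le_trans (ltW x1).
    rewrite [leLHS]/Num.norm /= mx_normrE; apply: bigmax_le => // i _.
    rewrite -(@ler_pXn2r _ 2)// ?nnegrE// expr1n -normrX ger0_norm ?sqr_ge0//.
    have <- : dotv t^T t^T = 1 by [].
    rewrite dotvE (bigD1 i.2)//= !mxE (ord1 i.1) -expr2 lerDl.
    by apply: sumr_ge0 => j _; rewrite -expr2 sqr_ge0.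
  have -> : S = (fun t : 'rV[R]_m.+1 => dotv t^T (1%:M *m t^T)) @^-1` [set 1].
    by apply/seteqP; split => t; rewrite /S /= mul1mx.
  apply: closed_comp => [x _|]; first exact: continuous_quadratic_form.
  exact: closed_eq.
have [c cS1 cmin] := EVT_min_rV S0 cS (continuous_subspaceT (@continuous_quadratic_form _ M)).
have {}cS1 : dotv c^T c^T = 1 by rewrite inE in cS1.
pose a := dotv c^T (M *m c^T).
have amin x : a * dotv x x <= dotv x (M *m x).
  have [->|x0] := eqVneq x 0; first by rewrite !dotv0l mulr0.
  have xx := dotv_gt0 x0.
  have s0 : Num.sqrt (dotv x x) != 0 by rewrite gt_eqF// sqrtr_gt0.
  have ss : Num.sqrt (dotv x x) ^+ 2 = dotv x x by rewrite sqr_sqrtr// dotv_ge0.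
  pose y := (Num.sqrt (dotv x x))^-1 *: x.
  have : y^T \in S.
    rewrite inE /S /= trmxK /y dotvZl dotvZr -{3}ss; field.
    by [].
  move=> /cmin; rewrite trmxK /y -scalemxAr dotvZl dotvZr mulrA -expr2 exprVn ss.
  by rewrite mulrC ler_pdivlMr.
exists a, c^T; split => //.
have B0 : (M - a%:M) *m c^T = 0.
  apply: psd_kernel.
  - by rewrite linearB /= Msym tr_scalar_mx.
  - move=> x; rewrite mulmxBl dotvBr mul_scalar_mx dotvZr subr_ge0.
    exact: amin.
  - by rewrite mulmxBl dotvBr mul_scalar_mx dotvZr cS1 mulr1 subrr.
by apply/eqP; rewrite -subr_eq0 -mul_scalar_mx -mulmxBl B0.
Qed.

(** The infimum in the definition of the smallest eigenvalue is attained at the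
  minimum of the Rayleigh quotient. *)
Lemma lambda_min_le m (M : 'M[R]_m) (x : 'cV[R]_m) : M^T = M ->
  lambda_min M * dotv x x <= dotv x (M *m x).
Proof.
move=> Msym; have [m0|m0] := posnP m.
  have -> : x = 0 by apply/colP => i; have := ltn_ord i; rewrite [X in (_ < X)%N]m0.
  by rewrite !dotv0l mulr0.
have [a [v [v1 Mv amin]]] := rayleigh_min m0 Msym.
apply: le_trans (amin x); apply: ler_wpM2r; first exact: dotv_ge0.
apply: ge_inf.
  exists a => b /= /eigenvalueP[w wM w0].
  have wT0 : w^T != 0 by rewrite trmx_eq0.
  have := amin w^T; rewrite -{1}Msym -trmx_mul wM linearZ /= dotvZr.
  by rewrite ler_pM2r// dotv_gt0.
apply/eigenvalueP; exists v^T.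
  by rewrite -{1}Msym -trmx_mul Mv linearZ.
by rewrite trmx_eq0; apply/eqP => v0; move: v1; rewrite v0 dotv0l => /eqP; rewrite eq_sym oner_eq0.
Qed.

Lemma sigma_max_ge0 m (M : 'M[R]_m) : 0 <= sigma_max M.
Proof.
have [[b Sb]|/set0P/negP] := pselect ([set Num.sqrt a | a in spectrum (M^T *m M)] !=set0).
  have [u|nu] := pselect (has_sup [set Num.sqrt a | a in spectrum (M^T *m M)]).
    have [a _ ab] := Sb.
    apply: le_trans (ub_le_sup u.2 Sb); by rewrite -ab sqrtr_ge0.
  by rewrite /sigma_max sup_out.
by rewrite negbK => /eqP E; rewrite /sigma_max E sup0.
Qed.

(** The same argument for the maximum, on the opposite of the Gram matrix. *)
Lemma sigma_max_ge m (M : 'M[R]_m) (x : 'cV[R]_m) :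
  dotv (M *m x) (M *m x) <= sigma_max M ^+ 2 * dotv x x.
Proof.
have [m0|m0] := posnP m.
  have -> : x = 0 by apply/colP => i; have := ltn_ord i; rewrite [X in (_ < X)%N]m0.
  by rewrite mulmx0 !dotv0l mulr0.
have Nsym : (- (M^T *m M))^T = - (M^T *m M).
  by rewrite linearN /= trmx_mul trmxK.
have [a [v [v1 Mv amin]]] := rayleigh_min m0 Nsym.
have MM y : dotv (M *m y) (M *m y) = dotv y ((M^T *m M) *m y).
  by rewrite -mulmxA [RHS]dotv_mulmx trmxK.
have amax y : dotv (M *m y) (M *m y) <= - a * dotv y y.
  by rewrite MM; have := amin y; rewrite mulNmx dotvNr; lra.
have Mv' : (M^T *m M) *m v = (- a) *: v by rewrite scaleNr -Mv mulNmx opprK.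
have a0 : 0 <= - a.
  have := dotv_ge0 (M *m v); rewrite MM Mv' dotvZr v1; lra.
apply: (le_trans (amax x)); apply: ler_wpM2r; first exact: dotv_ge0.
have Sa : [set Num.sqrt b | b in spectrum (M^T *m M)] (Num.sqrt (- a)).
  exists (- a) => //; apply/eigenvalueP; exists v^T.
    rewrite -[M^T *m M]trmxK -trmx_mul [X in X *m _]trmx_mul trmxK Mv'.
    by rewrite linearZ.
  by rewrite trmx_eq0; apply/eqP => v0; move: v1; rewrite v0 dotv0l => /eqP; rewrite eq_sym oner_eq0.
have ub : ubound [set Num.sqrt b | b in spectrum (M^T *m M)] (Num.sqrt (- a)).
  move=> _ [b /= /eigenvalueP[w wM w0] <-].
  have wT0 : w^T != 0 by rewrite trmx_eq0.
  apply: ler_wsqrtr.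
  have := amax w^T; rewrite MM.
  have -> : M^T *m M *m w^T = b *: w^T.
    by rewrite -linearZ /= -wM trmx_mul trmx_mul trmxK.
  by rewrite dotvZr ler_pM2r// dotv_gt0.
rewrite -[X in X <= _]sqr_sqrtr//; rewrite ler_pXn2r ?nnegrE ?sqrtr_ge0 ?sigma_max_ge0//.
by apply: ub_le_sup Sa; exists (Num.sqrt (- a)).
Qed.

End Rayleigh.

(** * The lasso under deterministic conditions *)

Section Lasso.
Context {R : realType}.

Definition quadratic_lasso p (H : 'M[R]_p) (G a0 : 'cV[R]_p) (lam a : R)
    (b : 'cV[R]_p) : R :=
  a - dotv G (b - a0) + dotv (b - a0) (H *m (b - a0)) / 2 + lam * norm1 b.

(** With [g] the negative gradient of the quadratic part at [b], the excess cost of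
  [c] is half the quadratic form at [c - b] plus the sum of the nonnegative terms
  [lam * `|c_i| - g_i * c_i].
  Outside [S] such a term vanishes only for [c_i = 0], which leaves a [c - b]
  supported in [S], where the form is definite. *)
Lemma lasso_kkt p (H : 'M[R]_p) (G a0 b : 'cV[R]_p) (lam a : R)
    (S : {set 'I_p}) :
  H^T = H -> (forall v, 0 <= dotv v (H *m v)) ->
  (forall v : 'cV[R]_p, (forall i, i \notin S -> v i 0 = 0) ->
    dotv v (H *m v) = 0 -> v = 0) ->
  let g := G - H *m (b - a0) in
  (forall i, i \in S -> g i 0 = lam * Num.sg (b i 0)) ->
  (forall i, i \notin S -> b i 0 = 0 /\ `|g i 0| < lam) ->
  0 < lam ->
  [set c | forall c', quadratic_lasso H G a0 lam a c <=
                      quadratic_lasso H G a0 lam a c'] = [set b].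
Proof.
move=> Hsym Hpos Hdef g gS gnS lam0.
have g_le i : `|g i 0| <= lam.
  have [iS|iS] := boolP (i \in S); last by have [_ /ltW] := gnS i iS.
  rewrite gS// normrM gtr0_norm// normr_sg.
  by rewrite ler_piMr ?(ltW lam0)//; case: (b i 0 != 0); rewrite ?ler01 ?lexx.
have term_ge0 (c : 'cV[R]_p) i : 0 <= lam * `|c i 0| - g i 0 * c i 0.
  rewrite subr_ge0 (le_trans (ler_norm _))// normrM.
  by apply: ler_wpM2r (g_le i); exact: normr_ge0.
have term_b i : lam * `|b i 0| - g i 0 * b i 0 = 0.
  have [iS|iS] := boolP (i \in S); last first.
    by have [-> _] := gnS i iS; rewrite normr0 !mulr0 subrr.
  by rewrite gS// -mulrA -normrEsg subrr.
have excess c : quadratic_lasso H G a0 lam a c - quadratic_lasso H G a0 lam a b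
    = dotv (c - b) (H *m (c - b)) / 2 +
      \sum_i (lam * `|c i 0| - g i 0 * c i 0).
  have sumE (d : 'cV[R]_p) : \sum_i (lam * `|d i 0| - g i 0 * d i 0) = lam * norm1 d - dotv g d.
    by rewrite sumrB -mulr_sumr dotvE.
  have Eb : lam * norm1 b = dotv g b.
    by apply/eqP; rewrite -subr_eq0 -sumE big1.
  have expand u v : dotv (v + u) (H *m (v + u)) =
      dotv v (H *m v) + 2 * dotv u (H *m v) + dotv u (H *m u).
    rewrite mulmxDr !dotvDr !dotvDl [dotv v (H *m u)]dotv_mulmx Hsym.
    by rewrite [dotv (H *m v) u]dotvC; ring.
  have gE d : dotv g d = dotv G d - dotv (b - a0) (H *m d).
    by rewrite [LHS]dotvBl [dotv (b - a0) _]dotv_mulmx Hsym.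
  have EG : dotv G (c - a0) = dotv G (c - b) + dotv G (b - a0).
    by rewrite -dotvDr addrA subrK.
  have Ec : dotv g c = dotv g (c - b) + dotv g b by rewrite -dotvDr subrK.
  rewrite sumE /quadratic_lasso Eb Ec (gE (c - b)) (gE b) EG.
  have -> : c - a0 = (c - b) + (b - a0) by rewrite addrA subrK.
  by rewrite expand; field.
apply/seteqP; split => [c /= cmin|_ -> c' /=]; last first.
  by rewrite -subr_ge0 excess addr_ge0 ?divr_ge0// sumr_ge0.
have ex0 : dotv (c - b) (H *m (c - b)) / 2 +
    \sum_i (lam * `|c i 0| - g i 0 * c i 0) = 0.
  apply/eqP; rewrite eq_le -excess subr_le0 cmin/= excess.
  by rewrite addr_ge0 ?divr_ge0// sumr_ge0.
move/eqP: ex0; rewrite paddr_eq0 ?divr_ge0 ?sumr_ge0// => /andP[/eqP q0].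
rewrite psumr_eq0 => [/allP s0|i _]; last exact: term_ge0.
have cS i : i \notin S -> c i 0 = 0.
  move=> iS; have [_ glt] := gnS i iS.
  have /= /eqP := s0 i (mem_index_enum _).
  apply: contra_eq => ci0; rewrite gt_eqF// subr_gt0.
  by rewrite (le_lt_trans (ler_norm _))// normrM ltr_pM2r// normr_gt0.
apply/eqP; rewrite -subr_eq0; apply/eqP; apply: Hdef => [i iS|].
  by rewrite !mxE cS// (gnS i iS).1 subrr.
by move/eqP: q0; rewrite mulf_eq0 invr_eq0 pnatr_eq0 orbF => /eqP.
Qed.

(** ** Coordinates in a subset *)

(** The isometric embedding of the coordinates in [S]: it turns the submatrices
  of the statement into products. *)
Definition coord_embed p (S : {set 'I_p}) : 'M[R]_(p, #|S|) :=
  \matrix_(i, j) (i == enum_val j)%:R.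

Lemma coord_embed_tr_mul p (S : {set 'I_p}) n (M : 'M[R]_(p, n)) j l :
  ((coord_embed S)^T *m M) j l = M (enum_val j) l.
Proof.
rewrite mxE (bigD1 (enum_val j))//= !mxE eqxx mul1r big1 ?addr0// => i ij.
by rewrite !mxE (negbTE ij) mul0r.
Qed.

Lemma mul_coord_embed p (S : {set 'I_p}) n (M : 'M[R]_(n, p)) i j :
  (M *m coord_embed S) i j = M i (enum_val j).
Proof.
rewrite mxE (bigD1 (enum_val j))//= !mxE eqxx mulr1 big1 ?addr0// => l lj.
by rewrite !mxE (negbTE lj) mulr0.
Qed.

Lemma submatrixE p (M : 'M[R]_p) (S T : {set 'I_p}) :
  submatrix M S T = (coord_embed S)^T *m M *m coord_embed T.
Proof.
by apply/matrixP => i j; rewrite mul_coord_embed coord_embed_tr_mul mxE.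
Qed.

Lemma coord_embed_in p (S : {set 'I_p}) (y : 'cV[R]_#|S|) j :
  (coord_embed S *m y) (enum_val j) 0 = y j 0.
Proof.
rewrite mxE (bigD1 j)//= !mxE eqxx mul1r big1 ?addr0// => l lj.
rewrite !mxE (_ : _ == _ = false) ?mul0r//.
by apply/negbTE; apply: contraNneq lj => /enum_val_inj ->.
Qed.

Lemma coord_embed_notin p (S : {set 'I_p}) (y : 'cV[R]_#|S|) i :
  i \notin S -> (coord_embed S *m y) i 0 = 0.
Proof.
move=> iS; rewrite mxE big1// => j _; rewrite !mxE (_ : _ == _ = false) ?mul0r//.
by apply/negbTE; apply: contraNneq iS => ->; exact: enum_valP.
Qed.

Lemma coord_embedK p (S : {set 'I_p}) (v : 'cV[R]_p) :
  (forall i, i \notin S -> v i 0 = 0) ->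
  v = coord_embed S *m ((coord_embed S)^T *m v).
Proof.
move=> vS; apply/colP => i; have [iS|iS] := boolP (i \in S); last first.
  by rewrite vS// coord_embed_notin.
rewrite -[i in RHS](enum_rankK_in iS iS) coord_embed_in coord_embed_tr_mul.
by rewrite enum_rankK_in.
Qed.

Lemma sqr_norm1_le m (y : 'cV[R]_m) : norm1 y ^+ 2 <= m%:R * dotv y y.
Proof.
pose u : 'cV[R]_m := \col_i 1; pose z : 'cV[R]_m := \col_i `|y i 0|.
have := cauchy_schwarz_dotv u z.
have -> : dotv u z = norm1 y.
  by rewrite dotvE; apply: eq_bigr => i _; rewrite !mxE mul1r.
have -> : dotv u u = m%:R.
  by rewrite dotvE (eq_bigr (fun=> 1)) => [|i _]; rewrite ?sumr_const ?card_ord// !mxE mul1r.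
have -> // : dotv z z = dotv y y.
by rewrite !dotvE; apply: eq_bigr => i _; rewrite !mxE -!expr2 real_normK ?num_real.
Qed.

Lemma mulmx_norm1_le m n (M : 'M[R]_(m, n)) (y : 'cV[R]_n) i e :
  (forall j, `|M i j| <= e) -> `|(M *m y) i 0| <= e * norm1 y.
Proof.
move=> Me; rewrite mxE (le_trans (ler_norm_sum _ _ _))// mulr_sumr.
by apply: ler_sum => j _; rewrite normrM ler_wpM2r.
Qed.

Lemma mulmx_sup_le m n (M : 'M[R]_(m, n)) (y : 'cV[R]_n) i e :
  (forall j, `|y j 0| <= e) -> `|(M *m y) i 0| <= (\sum_j `|M i j|) * e.
Proof.
move=> Me; rewrite mxE (le_trans (ler_norm_sum _ _ _))// mulr_suml.
by apply: ler_sum => j _; rewrite normrM ler_wpM2l.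
Qed.

Lemma dot_norm1_le m (u v : 'cV[R]_m) e :
  (forall i, `|v i 0| <= e) -> `|\sum_i u i 0 * v i 0| <= norm1 u * e.
Proof.
move=> ve; rewrite (le_trans (ler_norm_sum _ _ _))// mulr_suml.
by apply: ler_sum => j _; rewrite normrM ler_wpM2l.
Qed.

Lemma sg_perturb (a e : R) : `|e| < `|a| -> Num.sg (a + e) = Num.sg a.
Proof.
have [a0|a0|->] := ltgtP a 0; last by rewrite normr0 normr_lt0.
- rewrite (ltr0_norm a0) ltr_norml => /andP[e1 e2].
  by rewrite !ltr0_sg//; lra.
- rewrite (gtr0_norm a0) ltr_norml => /andP[e1 e2].
  by rewrite !gtr0_sg//; lra.
Qed.

Lemma incoherence_le1 p (Q : 'M[R]_p) (S : {set 'I_p}) : incoherence Q S <= 1.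
Proof. by rewrite /incoherence lerBlDr lerDl; exact: bigmax_ge_id. Qed.

Lemma incoherence_row p (Q : 'M[R]_p) (S : {set 'I_p}) i : i \notin S ->
  \sum_j `|(Q *m coord_embed S *m invmx (submatrix Q S S)) i j|
    <= 1 - incoherence Q S.
Proof.
move=> iS; rewrite /incoherence opprB addrCA subrr addr0 /op_norm_infty.
have iC : i \in ~: S by rewrite inE.
apply: le_trans (le_bigmax _ _ (enum_rank_in iC i)) => /=.
apply: ler_sum => j _; rewrite (submatrixE Q (~: S)) -!mulmxA coord_embed_tr_mul enum_rankK_in//.
Qed.

Lemma unitmx_definite m (M : 'M[R]_m) :
  (forall y : 'cV[R]_m, dotv y (M *m y) = 0 -> y = 0) -> M \in unitmx.
Proof.
move=> Mdef; rewrite unitmxE unitfE; apply/negP => /det0P[v v0 vM].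
have : v^T = 0.
  by apply: Mdef; rewrite dotv_mulmx -trmx_mul vM trmx0 dotv0l.
by apply/eqP; rewrite trmx_eq0.
Qed.

Lemma incoherence_margin (lam alpha e : R) : 0 < lam -> 0 < alpha -> 0 <= e ->
  let beta := lam * (1 + alpha / 3) in e <= alpha * beta / 6 ->
  lam * alpha / 3 + (e + ((1 - alpha) * beta + (1 - alpha) * e)) < lam.
Proof.
move=> lam0 alpha0 e0 beta.
have la2 : 0 < lam * alpha * alpha by rewrite !mulr_gt0.
have ae : 0 <= alpha * e by rewrite mulr_ge0// ltW.
have -> : alpha * beta = lam * alpha + lam * alpha * alpha / 3 by rewrite /beta; field.
have -> : (1 - alpha) * beta = lam - lam * alpha + lam * alpha / 3 -
    lam * alpha * alpha / 3 by rewrite /beta; field.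
by rewrite mulrBl mul1r; lra.
Qed.

(** The witness solves the least squares problem restricted to [S] with the
  penalty linearized at the true signs. Its distance to the truth is controlled
  in the 1-norm by [k / C], which fixes the signs; outside [S] the incoherence
  leaves a margin [alpha], shared in three between the gradient noise and the
  errors on the two blocks of the covariance. *)
Lemma lasso_sign_consistency p (Q H : 'M[R]_p) (G a0 : 'cV[R]_p)
    (lam a eps : R) (k : nat) :
  let S := supp a0 in let C := Cmin Q S in let alpha := incoherence Q S in
  Q^T = Q -> H^T = H -> (forall v, 0 <= dotv v (H *m v)) ->
  (#|S| <= k)%N -> 0 < C -> 0 < alpha -> 0 < lam -> 0 <= eps ->
  7 * (k%:R * eps) <= alpha * C ->
  (forall i j, j \in S -> `|H i j - Q i j| <= eps) ->
  (forall i, `|G i 0| <= lam * alpha / 3) ->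
  (forall i, i \in S -> 14 / 9 * k%:R * lam < C * `|a0 i 0|) ->
  exists b, [set c | forall c', quadratic_lasso H G a0 lam a c <=
                      quadratic_lasso H G a0 lam a c'] = [set b] /\
    signv b = signv a0.
Proof.
move=> S C alpha Qsym Hsym Hpos Sk C0 alpha0 lam0 eps0 keps HQ Gle amin.
have alpha1 : alpha <= 1 by exact: incoherence_le1.
pose E := coord_embed S; pose QS := submatrix Q S S.
have rowle i : i \notin S ->
  \sum_j `|(Q *m E *m invmx QS) i j| <= 1 - alpha by exact: incoherence_row.
clearbody alpha; pose HS := E^T *m H *m E.
have QSE : QS = E^T *m Q *m E by exact: submatrixE.
have QSsym : QS^T = QS by rewrite QSE !trmx_mul trmxK Qsym mulmxA.
have HS_QS i j : `|(HS - QS) i j| <= eps.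
  rewrite /HS QSE mxE [X in _ + X]mxE !mul_coord_embed !coord_embed_tr_mul.
  exact/HQ/enum_valP.
pose C' := C - k%:R * eps.
have C'0 : 6 / 7 * C <= C'.
  have : alpha * C <= C by rewrite ler_piMl// ltW.
  by rewrite /C'; move: keps; set z := k%:R * eps; lra.
have C'gt0 : 0 < C' by lra.
have norm1k (y : 'cV[R]_#|S|) : norm1 y ^+ 2 <= k%:R * dotv y y.
  apply: le_trans (sqr_norm1_le y) _.
  by apply: ler_wpM2r; [exact: dotv_ge0|rewrite ler_nat].
have norm1_ge0 (y : 'cV[R]_#|S|) : 0 <= norm1 y by exact: sumr_ge0.
have HSpos y : C' * dotv y y <= dotv y (HS *m y).
  have -> : HS = QS + (HS - QS) by rewrite addrC subrK.
  rewrite mulmxDl dotvDr mulrBl.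
  apply: lerD; first exact: lambda_min_le.
  have : `|dotv y ((HS - QS) *m y)| <= eps * norm1 y * norm1 y.
    rewrite mulrC dotvE; apply: dot_norm1_le => i.
    exact: mulmx_norm1_le.
  rewrite ler_norml => /andP[+ _]; apply: le_trans; rewrite lerN2.
  by rewrite -mulrA -expr2 [k%:R * _]mulrC -mulrA ler_wpM2l.
have HSdef y : dotv y (HS *m y) = 0 -> y = 0.
  move=> y0; apply: dotv_eq0; apply/eqP; rewrite eq_le dotv_ge0 andbT.
  by have := HSpos y; rewrite y0 pmulr_rle0.
have QSdef y : dotv y (QS *m y) = 0 -> y = 0.
  move=> y0; apply: dotv_eq0; apply/eqP; rewrite eq_le dotv_ge0 andbT.
  by have := lambda_min_le y QSsym; rewrite y0 pmulr_rle0.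
have HSunit := unitmx_definite HSdef.
have QSunit := unitmx_definite QSdef.
pose be := E^T *m (G - lam *: signv a0).
pose y := invmx HS *m be.
have HSy : HS *m y = be by rewrite mulKVmx.
pose beta := lam * (1 + alpha / 3).
have beta0 : 0 < beta by rewrite mulr_gt0//; lra.
have be_le j : `|be j 0| <= beta.
  rewrite coord_embed_tr_mul !mxE /beta mulrDr mulr1 [leRHS]addrC mulrA.
  apply: le_trans (ler_normB _ _) _; rewrite lerD// normrM gtr0_norm// normr_sg.
  by rewrite ler_piMr ?(ltW lam0)//; case: (a0 _ 0 != 0); rewrite ?ler01 ?lexx.
have Nle : C' * norm1 y <= k%:R * beta.
  have [->|N0] := eqVneq (norm1 y) 0.
    by rewrite mulr0 mulr_ge0// ltW.
  have {}N0 : 0 < norm1 y by rewrite lt0r N0 norm1_ge0.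
  rewrite -(ler_pM2r N0) -mulrA -expr2.
  apply: (@le_trans _ _ (C' * (k%:R * dotv y y))); first by rewrite ler_pM2l.
  rewrite mulrCA -mulrA ler_wpM2l// (le_trans (HSpos y))// HSy dotvE mulrC.
  by apply: le_trans (ler_norm _) _; exact: dot_norm1_le.
have y_le j : `|y j 0| <= norm1 y.
  by rewrite /norm1 (bigD1 j)//= lerDl sumr_ge0.
have betale : beta <= lam * (4 / 3) by rewrite ler_pM2l//; lra.
have CN : C * norm1 y <= 14 / 9 * k%:R * lam.
  have h1 : 6 / 7 * C * norm1 y <= C' * norm1 y by rewrite ler_wpM2r.
  have h2 : k%:R * beta <= k%:R * (lam * (4 / 3)) by rewrite ler_wpM2l.
  move: h1 h2 Nle; rewrite -!mulrA [k%:R * (lam * _)]mulrA.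
  set u := C * norm1 y; set v := k%:R * lam; set w := k%:R * beta.
  lra.
have y_lt i (iS : i \in S) : `|(E *m y) i 0| < `|a0 i 0|.
  rewrite -(enum_rankK_in iS iS) coord_embed_in (le_lt_trans (y_le _))//.
  rewrite -(ltr_pM2l C0) (le_lt_trans CN)// enum_rankK_in//.
  exact: amin.
have a0nS i : i \notin S -> a0 i 0 = 0.
  by rewrite inE negbK => /eqP.
have sgb i : Num.sg ((a0 + E *m y) i 0) = Num.sg (a0 i 0).
  have [iS|iS] := boolP (i \in S); last first.
    by rewrite mxE coord_embed_notin// addr0.
  by rewrite mxE sg_perturb// y_lt.
exists (a0 + E *m y); split; last by apply/colP => i; rewrite mxE sgb mxE.
have bE : a0 + E *m y - a0 = E *m y by rewrite addrC addKr.
apply: (@lasso_kkt p H G a0 (a0 + E *m y) lam a S) => //.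
- move=> v vS; rewrite (coord_embedK vS) -/E => v0; rewrite [X in E *m X]HSdef ?mulmx0//.
  by rewrite /HS -!mulmxA dotv_mulmx trmxK.
- move=> i iS; rewrite bE sgb.
  rewrite (_ : (G - H *m (E *m y)) i 0 =
      (E^T *m (G - H *m (E *m y))) (enum_rank_in iS i) 0); last first.
    by rewrite coord_embed_tr_mul enum_rankK_in.
  have HEy : E^T *m (H *m (E *m y)) = be by rewrite -HSy /HS !mulmxA.
  rewrite mulmxBr HEy /be mulmxBr subKr.
  by rewrite coord_embed_tr_mul enum_rankK_in// !mxE.
- move=> i iS; rewrite bE mxE coord_embed_notin// a0nS// addr0; split=> //.
  have HEy : H *m (E *m y) = (H - Q) *m E *m y +
      (Q *m E *m invmx QS *m be - Q *m E *m invmx QS *m ((HS - QS) *m y)).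
    rewrite -mulmxBr -HSy -mulmxBl subKr -!mulmxA mulKmx//.
    by rewrite -mulmxDl subrK.
  have {}rowle := rowle i iS.
  have entry (u1 u2 u3 u4 : 'cV[R]_p) : (u1 - (u2 + (u3 - u4))) i 0 =
    u1 i 0 - (u2 i 0 + (u3 i 0 - u4 i 0)) by rewrite !mxE.
  rewrite HEy entry.
  set N := norm1 y; have N0 : 0 <= N by exact: norm1_ge0.
  have t1 : `|((H - Q) *m E *m y) i 0| <= eps * N.
    apply: mulmx_norm1_le => j; rewrite mul_coord_embed !mxE.
    exact/HQ/enum_valP.
  have t2 : `|(Q *m E *m invmx QS *m be) i 0| <= (1 - alpha) * beta.
    apply: le_trans (mulmx_sup_le _ i be_le) _.
    by rewrite ler_wpM2r// ltW.
  have t3 : `|(Q *m E *m invmx QS *m ((HS - QS) *m y)) i 0| <= (1 - alpha) * (eps * N).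
    apply: (@le_trans _ _ ((\sum_j `|(Q *m E *m invmx QS) i j|) * (eps * N))).
      by apply: mulmx_sup_le => j; exact: mulmx_norm1_le.
    by rewrite ler_wpM2r// mulr_ge0.
  have epsN : eps * N <= alpha * beta / 6.
    rewrite -(ler_pM2l C'gt0) mulrCA.
    apply: (@le_trans _ _ (eps * (k%:R * beta))); first by rewrite ler_wpM2l.
    rewrite mulrA [eps * _]mulrC.
    have h : k%:R * eps <= alpha * (C' / 6) .
      have : alpha * (6 / 7 * C) <= alpha * C' by rewrite ler_pM2l.
      rewrite mulrCA => h; rewrite [leRHS]mulrA; move: h keps.
      clear; set u := k%:R * eps; set v := alpha * C; set w := alpha * C'.
      by move=> *; lra.
    apply: (@le_trans _ _ (alpha * (C' / 6) * beta)); first by rewrite ler_pM2r.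
    by rewrite le_eqVlt; apply/orP; left; apply/eqP; field.
  have Gi := Gle i.
  apply: le_lt_trans (ler_normB _ _) _.
  apply: le_lt_trans (lerD Gi (ler_normD _ _)) _.
  apply: le_lt_trans (incoherence_margin lam0 alpha0 (mulr_ge0 eps0 N0) epsN).
  rewrite lerD2l; apply: lerD => //.
  exact: le_trans (ler_normB _ _) (lerD t2 t3).
Qed.

End Lasso.

(** ** The least squares loss of a trajectory *)

Section EmpiricalCovariance.
Context {R : realType}.

Definition empirical_covariance p n (x : nat -> 'cV[R]_p) : 'M[R]_p :=
  n%:R^-1 *: \sum_(0 <= t < n) x t *m (x t)^T.

Lemma empirical_covarianceE p n (x : nat -> 'cV[R]_p) i j :
  empirical_covariance n x i j = n%:R^-1 * \sum_(0 <= t < n) x t i 0 * x t j 0.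
Proof.
rewrite mxE summxE; congr (_ * _); apply: eq_bigr => t _.
by rewrite mxE big_ord1 mxE.
Qed.

Lemma empirical_covariance_sym p n (x : nat -> 'cV[R]_p) :
  (empirical_covariance n x)^T = empirical_covariance n x.
Proof.
apply/matrixP => i j; rewrite mxE !empirical_covarianceE; congr (_ * _).
by apply: eq_bigr => t _; rewrite mulrC.
Qed.

Lemma empirical_covariance_form p n (x : nat -> 'cV[R]_p) v :
  dotv v (empirical_covariance n x *m v) =
  n%:R^-1 * \sum_(0 <= t < n) dotv v (x t) ^+ 2.
Proof.
rewrite -scalemxAl dotvZr mulmx_suml dotv_sumr; congr (_ * _).
apply: eq_bigr => t _.
rewrite -mulmxA [_ *m v]mx11_scalar -/(dotv (x t) v) mul_mx_scalar dotvZr.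
by rewrite expr2 [dotv (x t) v]dotvC.
Qed.

(** Expanding the loss around [a0], the residuals at [a0] give
  the constant and, correlated with the states, the gradient. *)
Lemma lasso_cost_quadratic p n (x : nat -> 'cV[R]_p) (r : 'I_p) (eta lam : R)
    (a0 b : 'cV[R]_p) : eta != 0 -> (0 < n)%N ->
  let e t := x t.+1 r 0 - x t r 0 - eta * dotv a0 (x t) in
  lasso_cost eta n x r lam b =
  quadratic_lasso (empirical_covariance n x)
    ((n%:R * eta)^-1 *: \sum_(0 <= t < n) e t *: x t) a0 lam
    ((2 * eta ^+ 2 * n%:R)^-1 * \sum_(0 <= t < n) e t ^+ 2) b.
Proof.
move=> eta0 n0 e; rewrite /lasso_cost /quadratic_lasso; congr (_ + _).
have n1 : n%:R != 0 :> R by rewrite pnatr_eq0 -lt0n.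
rewrite empirical_covariance_form dotvZl dotv_suml /least_squares_loss.
rewrite mulrAC !mulr_sumr mulr_suml -sumrN -!big_split /=; apply: eq_bigr => t _.
have -> : x t.+1 r 0 - x t r 0 - eta * dotv b (x t) =
    e t - eta * dotv (b - a0) (x t).
  by rewrite /e dotvBl; ring.
rewrite dotvZl [dotv (x t) _]dotvC; field.
by rewrite eta0 n1.
Qed.

End EmpiricalCovariance.

(** * Exponential moments of a Gaussian variable *)

Section GaussianMoments.
Context {R : realType}.
Local Notation mu := (@lebesgue_measure R).

(** The Radon-Nikodym derivative of the normal law agrees almost everywhere with
  the normal density. *)
Lemma integral_normal_prob (s : R) (h : R -> R) : s != 0 ->
  measurable_fun setT h -> (forall x, 0 <= h x) ->
  (\int[normal_prob 0 s]_x (h x)%:E =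
   \int[mu]_x (h x * normal_pdf 0 s x)%:E)%E.
Proof.
move=> s0 mh h0.
have dom := normal_prob_dominates 0 s.
have h0' x : (0 <= (h x)%:E)%E by rewrite lee_fin.
have mh' : measurable_fun setT (fun x : R => (h x)%:E) by exact/measurable_EFinP.
rewrite -(Radon_Nikodym_SigmaFinite.change_of_variables dom h0' _ mh')//.
have RNint := Radon_Nikodym_SigmaFinite.f_integrable dom.
have mpdf : measurable_fun setT (fun x : R => (normal_pdf 0 s x)%:E).
  apply/measurable_EFinP; exact: measurable_normal_pdf.
under [RHS]eq_integral do rewrite EFinM.
apply: ae_eq_integral => //.
- by apply: emeasurable_funM; [exact/measurable_EFinP|exact: measurable_int RNint].
- by apply: emeasurable_funM => //; exact/measurable_EFinP.
- have : ae_eq mu setT (Radon_Nikodym_SigmaFinite.f (normal_prob 0 s) mu)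
      (fun x : R => (normal_pdf 0 s x)%:E).
    apply: integral_ae_eq => //.
    by move=> E _ mE; rewrite -Radon_Nikodym_SigmaFinite.f_integral.
  by apply: filterS => x /= H D; rewrite H.
Qed.

(** Completing the square gives the normal density with the mean moved to
  [b * s ^+ 2]. *)
Lemma integral_normal_expR_linear (s b : R) : s != 0 ->
  (\int[normal_prob 0 s]_x (expR (b * x))%:E = (expR (b ^+ 2 * s ^+ 2 / 2))%:E)%E.
Proof.
move=> s0; rewrite integral_normal_prob//; last first.
  by apply: measurableT_comp => //; exact: measurable_funM.
transitivity (\int[mu]_x ((expR (b ^+ 2 * s ^+ 2 / 2))%:E *
    (normal_pdf (b * s ^+ 2) s x)%:E))%E.
  apply: eq_integral => x _; rewrite -EFinM !normal_pdfE// /normal_fun.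
  congr (_%:E); rewrite mulrCA [in RHS]mulrCA; congr (_ * _).
  rewrite -!expRD; congr expR; field.
  exact: s0.
rewrite ge0_integralZl//.
- by rewrite integral_normal_pdf mule1.
- apply/measurable_EFinP; exact: measurable_normal_pdf.
- by move=> x _; rewrite lee_fin normal_pdf_ge0.
Qed.

(** From [(1 - c)^-1 = 1 + c / (1 - c)] and [1 + y <= expR y]. *)
Lemma invf_1B_le_expR (c : R) : `|c| <= 1 / 2 ->
  (1 - c)^-1 <= expR (c + 2 * c ^+ 2).
Proof.
rewrite ler_norml => /andP[c1 c2].
have c0 : 0 < 1 - c by lra.
have -> : (1 - c)^-1 = 1 + c / (1 - c) by field; rewrite gt_eqF.
apply: le_trans (expR_ge1Dx _) _.
rewrite ler_expR ler_pdivrMr// -subr_ge0.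
have -> : (c + 2 * c ^+ 2) * (1 - c) - c = c ^+ 2 * (1 - 2 * c) by ring.
by rewrite mulr_ge0 ?sqr_ge0//; lra.
Qed.

(** The integrand is a multiple of the normal density with variance
  [s ^+ 2 / (1 - c)], where [c = 2 * (a * s ^+ 2)], so that the integral is the
  inverse square root of [1 - c]. *)
Lemma integral_normal_expR_square (s a : R) : s != 0 ->
  `|a * s ^+ 2| <= 1 / 4 ->
  (\int[normal_prob 0 s]_x (expR (a * x ^+ 2))%:E <=
   (expR (a * s ^+ 2 + 4 * (a * s ^+ 2) ^+ 2))%:E)%E.
Proof.
move=> s0 as4; rewrite integral_normal_prob//; last first.
  by apply: measurableT_comp => //; apply: measurable_funM => //; exact: measurable_funX.
pose c := 2 * (a * s ^+ 2).
have c2 : `|c| <= 1 / 2 by rewrite normrM ger0_norm//; lra.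
have c1 : 0 < 1 - c by move: c2; rewrite ler_norml => /andP[]; lra.
have s2 : 0 < s ^+ 2 by rewrite exprn_even_gt0.
pose s' := Num.sqrt (s ^+ 2 / (1 - c)).
have s'2 : s' ^+ 2 = s ^+ 2 / (1 - c) by rewrite sqr_sqrtr// divr_ge0 ?ltW.
have s'0 : s' != 0 by rewrite gt_eqF// sqrtr_gt0 divr_gt0.
pose K := normal_peak s / normal_peak s'.
have K0 : 0 <= K by rewrite divr_ge0 ?normal_peak_ge0.
apply: (@le_trans _ _ (\int[mu]_x (K%:E * (normal_pdf 0 s' x)%:E))%E).
  rewrite le_eqVlt; apply/orP; left; apply/eqP.
  apply: eq_integral => x _; rewrite -EFinM !normal_pdfE// /normal_fun.
  congr (_%:E); rewrite /K mulrCA -[RHS]mulrA mulKf; last first.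
    by rewrite gt_eqF// normal_peak_gt0.
  congr (_ * _).
  rewrite -!expRD; congr expR; rewrite s'2 /c; field.
  by rewrite s0/= gt_eqF.
rewrite ge0_integralZl//; last 2 first.
- apply/measurable_EFinP; exact: measurable_normal_pdf.
- by move=> x _; rewrite lee_fin normal_pdf_ge0.
rewrite integral_normal_pdf mule1 lee_fin.
rewrite -(@ler_pXn2r _ 2)// ?nnegrE ?expR_ge0// -expRM_natl.
have -> : K ^+ 2 = (1 - c)^-1.
  have pi0 := @pi_gt0 R; have spi t : 0 <= t ^+ 2 * pi *+ 2 :> R.
    by rewrite mulrn_wge0// mulr_ge0 ?sqr_ge0// ltW.
  rewrite /K /normal_peak expr_div_n !exprVn (sqr_sqrtr (spi s)) (sqr_sqrtr (spi s')) s'2.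
  by move: pi0; move: (@pi R) => q q0; field; rewrite s0 !gt_eqF.
apply: le_trans (invf_1B_le_expR c2) _; rewrite ler_expR.
by rewrite /c le_eqVlt; apply/orP; left; apply/eqP; ring.
Qed.

End GaussianMoments.

Section GaussianVariable.
Context {d : measure_display} {T : measurableType d} {R : realType}.
Variables (P : probability T R) (Y : T -> R) (v : R).
Hypotheses (mY : measurable_fun setT Y) (v0 : 0 <= v).
Hypothesis lawY : forall B : set R, measurable B ->
  P (Y @^-1` B) = centered_normal v B.

Lemma centered_normal_integral (h : R -> R) :
  measurable_fun setT h -> (forall x, 0 <= h x) ->
  (\int[P]_w (h (Y w))%:E = if (v == 0)%R then (h 0%R)%:E else
     \int[normal_prob 0 (Num.sqrt v)]_x (h x)%:E)%E.
Proof.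
move=> mh h0.
have mh' : measurable_fun setT (fun x : R => (h x)%:E) by exact/measurable_EFinP.
transitivity (\int[pushforward P (Y : T -> measurableTypeR R)]_x (h x)%:E)%E.
  by rewrite ge0_integral_pushforward// => x _; rewrite lee_fin.
case: ifPn => v_0.
  rewrite (eq_measure_integral \d_(0 : measurableTypeR R)) => [|A mA _]; last first.
    by rewrite /= /pushforward lawY// /centered_normal v_0.
  by rewrite integral_dirac// diracT mul1e.
rewrite [LHS](eq_measure_integral (normal_prob 0 (Num.sqrt v)))// => A mA _.
by rewrite /= /pushforward lawY// /centered_normal (negbTE v_0).
Qed.

Lemma gaussian_expR_linear b :
  (\int[P]_w (expR (b * Y w))%:E = (expR (b ^+ 2 * v / 2))%:E)%E.
Proof.
rewrite (centered_normal_integral (h := fun x => expR (b * x))); last 2 first.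
- by apply: measurableT_comp => //; exact: measurable_funM.
- by move=> x; exact: expR_ge0.
have [->|vn0] := eqVneq v 0; first by rewrite !mulr0 mul0r.
have s0 : Num.sqrt v != 0 by rewrite gt_eqF// sqrtr_gt0 lt0r vn0.
by rewrite integral_normal_expR_linear// sqr_sqrtr.
Qed.

Lemma gaussian_expR_square a : `|a * v| <= 1 / 4 ->
  (\int[P]_w (expR (a * Y w ^+ 2))%:E <= (expR (a * v + 4 * (a * v) ^+ 2))%:E)%E.
Proof.
move=> av; rewrite (centered_normal_integral (h := fun x => expR (a * x ^+ 2))); last 2 first.
- by apply: measurableT_comp => //; apply: measurable_funM => //; exact: measurable_funX.
- by move=> x; exact: expR_ge0.
have [->|vn0] := eqVneq v 0; first by rewrite !(expr0n, mulr0, addr0).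
have s0 : Num.sqrt v != 0 by rewrite gt_eqF// sqrtr_gt0 lt0r vn0.
have := @integral_normal_expR_square R (Num.sqrt v) a s0.
by rewrite sqr_sqrtr//; apply.
Qed.

End GaussianVariable.

(** * The past of the process and the next noise vector *)

Section IndependentIntegral.
Context d d1 d2 (T : measurableType d) (T1 : measurableType d1)
  (T2 : measurableType d2) (R : realType) (P : probability T R).
Variables (f : {mfun T >-> T1}) (g : {mfun T >-> T2}).
Hypothesis fg_indep : forall A B, measurable A -> measurable B ->
  P (f @^-1` A `&` g @^-1` B) = (P (f @^-1` A) * P (g @^-1` B))%E.

(** The joint law of independent variables is the product of the marginal laws,
  so Tonelli applies. *)
Lemma independent_integral (phi : (T1 * T2)%type -> \bar R) :
  measurable_fun setT phi -> (forall z, 0 <= phi z)%E ->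
  (\int[P]_w phi (f w, g w) =
   \int[distribution P f]_a \int[distribution P g]_b phi (a, b))%E.
Proof.
move=> mphi phi0.
have mfg : measurable_fun setT (fun w => (f w, g w)) by exact: measurable_fun_pair.
pose h : {mfun T >-> (T1 * T2)%type} := HB.pack (fun w => (f w, g w))
  (isMeasurableFun.Build _ _ _ _ _ mfg).
transitivity (\int[distribution P h]_z phi z)%E.
  by rewrite ge0_integral_distribution.
have <- := fubini_tonelli1 (m1 := distribution P f) (m2 := distribution P g)
  phi mphi phi0.
apply: eq_measure_integral => A mA _; symmetry.
by apply: product_measure_unique => // B C mB mC; exact: fg_indep.
Qed.

End IndependentIntegral.

Section PastNoise.
Context {d : measure_display} {T : measurableType d} {R : realType}.
Variables (P : probability T R) (p : nat) (x w : nat -> T -> 'cV[R]_p).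

Definition coordinate_events (I : Type) (X : I -> T -> 'cV[R]_p) : set (set T) :=
  [set E | exists i j B, measurable B /\
         E = (fun omega => X i omega j 0) @^-1` B].

(** The independent vectors from which the process is built: the initial state,
  then the noises. *)
Definition driver (t : nat) : T -> 'cV[R]_p := if t is s.+1 then w s.+1 else x 0.

Definition past (t : nat) : set (set T) :=
  coordinate_events (fun s : 'I_t.+1 => driver s).

Definition noise (t : nat) : set (set T) :=
  coordinate_events (fun _ : unit => w t).

Hypothesis mdriver : forall t i, measurable_fun setT (fun omega => driver t omega i 0).

Lemma sub_sigma_generated (I J : Type) (X : I -> T -> 'cV[R]_p)
    (Y : J -> T -> 'cV[R]_p) : (forall i, exists j, X i = Y j) ->
  sigma_generated X `<=` sigma_generated Y.
Proof.
move=> XY; apply: smallest_sub; first exact: smallest_sigma_algebra.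
move=> E [i [j [B [mB ->]]]]; apply: sub_sigma_algebra.
by have [i' ->] := XY i; exists i', j, B.
Qed.

Lemma sigma_generated_measurable (I : Type) (X : I -> T -> 'cV[R]_p) :
  (forall i j, measurable_fun setT (fun omega => X i omega j 0)) ->
  sigma_generated X `<=` measurable.
Proof.
move=> mX; apply: smallest_sub; first exact: sigma_algebra_measurable.
by move=> E [i [j [B [mB ->]]]]; rewrite -[X in measurable X]setTI; exact: mX.
Qed.

Lemma sigma_generated_setI (I : Type) (X : I -> T -> 'cV[R]_p) E F :
  sigma_generated X E -> sigma_generated X F -> sigma_generated X (E `&` F).
Proof. exact: (@measurableI _ (g_sigma_algebraType (coordinate_events X))). Qed.

Fixpoint first_times (n : nat) : {fset nat} :=
  if n is m.+1 then (m |` first_times m)%fset else fset0.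

Lemma in_first_times n t : (t \in first_times n) = (t < n)%N.
Proof.
elim: n => [|n IHn] /=; first by rewrite inE.
by rewrite in_fset1U IHn ltnS [RHS]leq_eqVlt.
Qed.

Hypothesis noise_indep : mutually_independent P (fun t => w t.+1).
Hypothesis init_indep : independent_of_family P (x 0) (fun t => w t.+1).

Lemma prob_noises n (E : nat -> set T) :
  (forall t, sigma_generated (fun _ : unit => w t.+1) (E t)) ->
  P (\bigcap_(t in [set t | (t < n.+1)%N]) E t) =
  (P (\bigcap_(t in [set t | (t < n)%N]) E t) * P (E n))%E.
Proof.
move=> sE.
have setE m : [set t | (t < m)%N] = [set` first_times m].
  by apply/seteqP; split => t /=; rewrite in_first_times.
rewrite !setE !noise_indep//= big_fsetU1 ?in_first_times ?ltnn//=.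
by rewrite muleC.
Qed.

Lemma bigcap_ltnS (E : nat -> set T) n :
  \bigcap_(t in [set t | (t < n.+1)%N]) E t =
  \bigcap_(t in [set t | (t < n)%N]) E t `&` E n.
Proof.
apply/seteqP; split => [y Ey|y [Ey En] t /=].
  by split => [t /= tn|]; apply: Ey => //=; rewrite ltnS ltnW.
by rewrite ltnS leq_eqVlt => /orP[/eqP->//|]; exact: Ey.
Qed.

Lemma sigma_noises n (E : nat -> set T) :
  (forall t, sigma_generated (fun _ : unit => w t.+1) (E t)) ->
  sigma_generated (fun t => w t.+1) (\bigcap_(t in [set t | (t < n)%N]) E t).
Proof.
move=> sE; elim: n => [|n IHn].
  rewrite (_ : \bigcap_(_ in _) _ = setT); last by apply/seteqP; split.
  exact: (@measurableT _ (g_sigma_algebraType (coordinate_events (fun t => w t.+1)))).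
rewrite bigcap_ltnS; apply: sigma_generated_setI => //.
by apply: sub_sigma_generated (sE n); exists n.
Qed.

(** Intersections of one event per driving vector are stable by intersection and
  generate the past, so it is enough to check independence on them. *)
Lemma independent_past t E F :
  sigma_generated (fun s : 'I_t.+1 => driver s) E ->
  sigma_generated (fun _ : unit => w t.+1) F ->
  P (E `&` F) = (P E * P F)%E.
Proof.
move=> sE sF.
have mw s i : measurable_fun setT (fun omega => w s.+1 omega i 0) by exact: mdriver s.+1 i.
have mF : measurable F by apply: sigma_generated_measurable sF => _; exact: mw.
pose pi_sys : set (set T) := [set A | exists E0 (Es : nat -> set T),
  [/\ sigma_generated (fun _ : unit => x 0) E0,
    forall s, sigma_generated (fun _ : unit => w s.+1) (Es s) &
    A = E0 `&` \bigcap_(s in [set s | (s < t)%N]) Es s]].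
have sT (X : unit -> T -> 'cV[R]_p) : sigma_generated X setT.
  exact: (@measurableT _ (g_sigma_algebraType (coordinate_events X))).
have pi_meas : pi_sys `<=` measurable.
  move=> _ [E0 [Es [sE0 sEs ->]]]; apply: measurableI.
    by apply: sigma_generated_measurable sE0 => _; exact: mdriver 0%N.
  by apply: sigma_generated_measurable (sigma_noises t sEs).
have pi_setI : setI_closed pi_sys.
  move=> _ _ [E0 [Es [sE0 sEs ->]]] [E0' [Es' [sE0' sEs' ->]]].
  exists (E0 `&` E0'), (fun s => Es s `&` Es' s); split.
  - exact: sigma_generated_setI.
  - by move=> s; exact: sigma_generated_setI.
  - by rewrite bigcapI setIACA.
have pi_T : pi_sys setT.
  exists setT, (fun=> setT); split => //.
  by apply/seteqP; split.
have past_pi : past t `<=` pi_sys.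
  move=> _ [[[|s] st] [j [B [mB ->]]]].
    exists ((fun omega => x 0 omega j 0) @^-1` B), (fun=> setT); split => //.
      by apply: sub_sigma_algebra; exists tt, j, B.
    by apply/seteqP; split => // y [].
  pose V := (fun omega => w s.+1 omega j 0) @^-1` B.
  exists setT, (fun s' => if s' == s then V else setT); split => //.
    move=> s'; case: eqP => [->|_]; last exact: sT.
    by apply: sub_sigma_algebra; exists tt, j, B.
  rewrite setTI; apply/seteqP; split => [y Vy s' _ /=|y Vy].
    by case: eqP.
  by have := Vy s st; rewrite /= eqxx.
have PF0 : 0 <= fine (P F) by exact: fine_ge0.
have PFE : P F = (fine (P F))%:E by rewrite fineK// fin_num_measure.
have agree A : pi_sys A -> P (A `&` F) = (P F * P A)%E.
  move=> [E0 [Es [sE0 sEs ->]]].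
  pose Es' s := if s == t then F else Es s.
  have sEs' s : sigma_generated (fun _ : unit => w s.+1) (Es' s).
    by rewrite /Es'; case: eqP => [->|].
  have EsE : \bigcap_(s in [set s | (s < t)%N]) Es' s =
      \bigcap_(s in [set s | (s < t)%N]) Es s.
    by apply: eq_bigcapr => s /= st; rewrite /Es' ltn_eqF.
  have := prob_noises t sEs'; rewrite bigcap_ltnS EsE {1 2}/Es' eqxx => PEsF.
  rewrite -setIA init_indep//; last first.
    have := sigma_noises t.+1 sEs'; rewrite bigcap_ltnS EsE {1}/Es' eqxx; exact.
  rewrite PEsF init_indep//; last exact: sigma_noises.
  by rewrite muleA muleC.
have scaleE A : mscale (NngNum PF0) P A = (P F * P A)%E by rewrite [in RHS]PFE.
have coverE : \bigcup_(_ in [set: nat]) [set: T] = [set: T].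
  by rewrite bigcup_const//; exists 0%N.
have finE : nat -> (mrestr P mF setT < +oo)%E.
  by move=> _; rewrite /mrestr (le_lt_trans (probability_le1 _ _))// ?setTI ?ltry.
have := @g_sigma_algebra_measure_unique _ R T pi_sys pi_meas (fun=> setT)
  (fun=> pi_T) coverE (mrestr P mF) (mscale (NngNum PF0) P) pi_setI _ finE E.
move=> uniq; rewrite -[LHS]/(mrestr P mF E) muleC -scaleE; apply: uniq.
  by move=> A pA; exact: (etrans (agree A pA) (esym (scaleE A))).
by apply: sub_smallest2r sE.
Qed.

Notation pastT t := (g_sigma_algebraType (past t)).
Notation noiseT t := (g_sigma_algebraType (noise t)).

Lemma measurable_driver_past s t i : (s <= t)%N ->
  measurable_fun setT (fun omega : pastT t => driver s omega i 0).
Proof.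
move=> st _ B mB; rewrite setTI; apply: sub_sigma_algebra.
by exists (Ordinal (st : (s < t.+1)%N)), i, B.
Qed.

Lemma measurable_noise t i :
  measurable_fun setT (fun omega : noiseT t => w t omega i 0).
Proof.
by move=> _ B mB; rewrite setTI; apply: sub_sigma_algebra; exists tt, i, B.
Qed.

Lemma measurable_id_past t : measurable_fun setT (idfun : T -> pastT t).
Proof.
move=> _ A mA; rewrite setTI preimage_id.
by apply: sigma_generated_measurable mA => i j; exact: mdriver.
Qed.

Lemma measurable_id_noise t : measurable_fun setT (idfun : T -> noiseT t.+1).
Proof.
move=> _ A mA; rewrite setTI preimage_id.
by apply: sigma_generated_measurable mA => _ j; exact: (mdriver t.+1).
Qed.

(** The past and the next noise vector are independent, so their joint law is a
  product, and by Tonelli the integral over the noise can be bounded first. *)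
Lemma expectation_freeze_past_le t (phi : T -> T -> R) (psi : T -> R) :
  measurable_fun setT (fun z : (pastT t * noiseT t.+1)%type => phi z.1 z.2) ->
  measurable_fun setT (psi : pastT t -> R) ->
  (forall a b, 0 <= phi a b) ->
  (forall a, (\int[P]_b (phi a b)%:E <= (psi a)%:E)%E) ->
  (\int[P]_a (phi a a)%:E <= \int[P]_a (psi a)%:E)%E.
Proof.
move=> mphi mpsi phi0 phi_psi.
pose f : {mfun T >-> pastT t} := HB.pack (idfun : T -> pastT t)
  (isMeasurableFun.Build _ _ _ _ _ (@measurable_id_past t)).
pose g : {mfun T >-> noiseT t.+1} := HB.pack (idfun : T -> noiseT t.+1)
  (isMeasurableFun.Build _ _ _ _ _ (@measurable_id_noise t)).
have fg A B : measurable A -> measurable B ->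
    P (f @^-1` A `&` g @^-1` B) = (P (f @^-1` A) * P (g @^-1` B))%E.
  by move=> mA mB; exact: independent_past mA mB.
pose Phi (z : (pastT t * noiseT t.+1)%type) : \bar R := (phi z.1 z.2)%:E.
have mPhi : measurable_fun setT Phi by exact/measurable_EFinP.
have Phi0 z : (0 <= Phi z)%E by rewrite lee_fin.
have -> : (\int[P]_a (phi a a)%:E = \int[P]_w Phi (f w, g w))%E by [].
rewrite (independent_integral fg mPhi Phi0).
have psi0 a : (0 <= (psi a)%:E)%E.
  by apply: le_trans (phi_psi a); apply: integral_ge0 => b _; rewrite lee_fin.
have -> : (\int[P]_a (psi a)%:E = \int[distribution P f]_a (psi a)%:E)%E.
  by rewrite ge0_integral_distribution//; exact/measurable_EFinP.
apply: ge0_le_integral => //.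
- by move=> a _; exact: integral_ge0.
- exact: measurable_fun_fubini_tonelli_F.
- exact/measurable_EFinP.
- move=> a _; apply: le_trans (phi_psi a); rewrite ge0_integral_distribution//.
  by apply: measurableT_comp mPhi _; exact: measurable_pair1.
Qed.

End PastNoise.

(** * Exponential moments of quadratic forms in Gaussian vectors *)

Section QuadraticForms.
Context {R : realType}.

(** The tangent of the exponential at the weighted mean lies below it. *)
Lemma expR_convex_sum m (c y : 'I_m -> R) : (forall i, 0 <= c i) ->
  \sum_i c i = 1 -> expR (\sum_i c i * y i) <= \sum_i c i * expR (y i).
Proof.
move=> c0 c1; set a := \sum_i c i * y i.
apply: (@le_trans _ _ (\sum_i c i * (expR a * (1 + (y i - a))))).
  rewrite le_eqVlt; apply/orP; left; apply/eqP.
  under eq_bigr do rewrite mulrCA mulrDr mulr1 mulrBr.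
  by rewrite -mulr_sumr big_split /= sumrB -mulr_suml c1 mul1r subrr addr0 mulr1.
apply: ler_sum => i _; apply: ler_wpM2l => //.
rewrite -[y i in leRHS](subrKC a) expRD ler_wpM2l ?expR_ge0//.
exact: expR_ge1Dx.
Qed.

(** Quadratic forms are kept as weighted sums of squares of linear functionals, so
  that convexity can be applied term by term. *)
Definition wform p m (c : 'I_m -> R) (v : 'I_m -> 'cV[R]_p) (y : 'cV[R]_p) : R :=
  \sum_i c i * dotv (v i) y ^+ 2.

Definition wtrace p m (c : 'I_m -> R) (v : 'I_m -> 'cV[R]_p) (Q : 'M[R]_p) : R :=
  \sum_i c i * dotv (v i) (Q *m v i).

Lemma wform_ge0 p m (c : 'I_m -> R) (v : 'I_m -> 'cV[R]_p) y :
  (forall i, 0 <= c i) -> 0 <= wform c v y.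
Proof. by move=> c0; apply: sumr_ge0 => i _; rewrite mulr_ge0// sqr_ge0. Qed.

(** Half the gradient of the form at [y]. *)
Definition wgrad p m (c : 'I_m -> R) (v : 'I_m -> 'cV[R]_p) (y : 'cV[R]_p) :=
  \sum_i (c i * dotv (v i) y) *: v i.

Lemma wformD p m (c : 'I_m -> R) (v : 'I_m -> 'cV[R]_p) y z :
  wform c v (y + z) = wform c v y + 2 * dotv (wgrad c v y) z + wform c v z.
Proof.
rewrite /wform /wgrad dotv_suml mulr_sumr -!big_split /=; apply: eq_bigr => i _.
by rewrite dotvDr dotvZl; ring.
Qed.

(** The largest eigenvalue of the form is at most its trace. *)
Lemma wgrad_le p m (c : 'I_m -> R) (v : 'I_m -> 'cV[R]_p) y :
  (forall i, 0 <= c i) ->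
  dotv (wgrad c v y) (wgrad c v y) <=
  (\sum_i c i * dotv (v i) (v i)) * wform c v y.
Proof.
move=> c0; set z := wgrad c v y; set N := \sum_i _.
have [->|z0] := eqVneq (dotv z z) 0.
  rewrite mulr_ge0 ?wform_ge0//; apply: sumr_ge0 => i _.
  by rewrite mulr_ge0// dotv_ge0.
have zz : 0 < dotv z z by rewrite lt0r z0 dotv_ge0.
rewrite -(ler_pM2r zz).
pose a : 'cV[R]_m := \col_i (Num.sqrt (c i) * dotv (v i) y).
pose b : 'cV[R]_m := \col_i (Num.sqrt (c i) * dotv (v i) z).
have cE i : Num.sqrt (c i) * Num.sqrt (c i) = c i by rewrite -expr2 sqr_sqrtr.
have ab : dotv z z = dotv a b.
  rewrite {1}/z /wgrad dotv_suml dotvE; apply: eq_bigr => i _.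
  by rewrite !mxE dotvZl mulrACA cE mulrA.
have aa : dotv a a = wform c v y.
  by rewrite dotvE; apply: eq_bigr => i _; rewrite !mxE mulrACA cE.
have bb : dotv b b <= N * dotv z z.
  rewrite dotvE mulr_suml; apply: ler_sum => i _.
  rewrite !mxE mulrACA cE -mulrA ler_wpM2l// -expr2.
  exact: cauchy_schwarz_dotv.
rewrite -expr2 {1}ab; apply: le_trans (cauchy_schwarz_dotv a b) _.
rewrite aa [N * _]mulrC -mulrA ler_wpM2l// wform_ge0//.
Qed.

End QuadraticForms.

Section GaussianVectors.
Context {d : measure_display} {T : measurableType d} {R : realType}.
Variables (P : probability T R) (p : nat) (X : T -> 'cV[R]_p) (Q : 'M[R]_p).
Hypothesis gX : centered_gaussian_vector P X Q.

Lemma measurable_dotv (d' : measure_display) (T' : measurableType d')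
    (Y : T' -> 'cV[R]_p) (u : 'cV[R]_p) :
  (forall i, measurable_fun setT (fun omega => Y omega i 0)) ->
  measurable_fun setT (fun omega => dotv u (Y omega)).
Proof.
move=> mY; under eq_fun do rewrite dotvE.
by apply: measurable_sum => i; exact: measurable_funM.
Qed.

Lemma measurable_wform (d' : measure_display) (T' : measurableType d')
    (Y : T' -> 'cV[R]_p) m (c : 'I_m -> R) v :
  (forall i, measurable_fun setT (fun omega => Y omega i 0)) ->
  measurable_fun setT (fun omega => wform c v (Y omega)).
Proof.
move=> mY; apply: measurable_sum => i; apply: measurable_funM => //.
by apply: measurable_funX; exact: measurable_dotv.
Qed.

Lemma gaussian_vector_expR_dotv u :
  (\int[P]_w (expR (dotv u (X w)))%:E = (expR (dotv u (Q *m u) / 2))%:E)%E.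
Proof.
have [mX Qsym Qpos law] := gX.
have := gaussian_expR_linear (measurable_dotv u mX) (Qpos u) (law u) 1.
by rewrite expr1n mul1r; under eq_integral do rewrite mul1r.
Qed.

(** By convexity of the exponential, the form can be replaced by its trace times
  the square of one normalized coordinate: a bound free of the dimension. *)
Lemma gaussian_vector_expR_wform m (c : 'I_m -> R) v a :
  (forall u, dotv u (Q *m u) = 0 -> u = 0) -> (forall i, 0 <= c i) ->
  `|a * wtrace c v Q| <= 1 / 4 ->
  (\int[P]_w (expR (a * wform c v (X w)))%:E <=
   (expR (a * wtrace c v Q + 4 * (a * wtrace c v Q) ^+ 2))%:E)%E.
Proof.
have [mX Qsym Qpos law] := gX => Qdef c0; set tau := wtrace c v Q => atau.
pose t i := dotv (v i) (Q *m v i).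
have t0 i : 0 <= t i by exact: Qpos.
have vt0 i : t i = 0 -> v i = 0 by exact: Qdef.
have [tau0|tau0] := eqVneq tau 0.
  have form0 y : wform c v y = 0.
    apply: big1 => i _; move/eqP: tau0; rewrite psumr_eq0 => [|j _]; last first.
      by rewrite mulr_ge0.
    move/allP => /(_ i (mem_index_enum _)) /=; rewrite mulf_eq0 => /orP[/eqP->|/eqP/vt0->].
      by rewrite mul0r.
    by rewrite dotv0l expr0n mulr0.
  under eq_integral do rewrite form0 mulr0 expR0.
  by rewrite integral_cst//= probability_setT mule1 tau0 !(mulr0, expr0n, addr0) expR0.
pose pi i := c i * t i / tau.
have tau_gt0 : 0 < tau by rewrite lt0r tau0 sumr_ge0// => i _; rewrite mulr_ge0.
have pi0 i : 0 <= pi i by rewrite divr_ge0 ?mulr_ge0// ltW.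
have pi1 : \sum_i pi i = 1 by rewrite -mulr_suml divff.
pose Y i w := a * tau / t i * dotv (v i) (X w) ^+ 2.
have formE w : a * wform c v (X w) = \sum_i pi i * Y i w.
  rewrite /wform mulr_sumr; apply: eq_bigr => i _; rewrite /pi /Y.
  have [ti|ti] := eqVneq (t i) 0.
    by rewrite (vt0 i ti) dotv0l expr0n !mulr0.
  by field; rewrite tau0 ti.
have mY i : measurable_fun setT (fun w => expR (Y i w)).
  apply: measurableT_comp => //; apply: measurable_funM => //.
  by apply: measurable_funX; exact: measurable_dotv.
apply: (@le_trans _ _ (\int[P]_w (\sum_i (pi i)%:E * (expR (Y i w))%:E))%E).
  apply: ge0_le_integral => //.
  - apply/measurable_EFinP; apply: measurableT_comp => //.
    by apply: measurable_funM => //; exact: measurable_wform.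
  - apply: emeasurable_sum => i; apply: emeasurable_funM => //.
    exact/measurable_EFinP.
  - move=> w _; rewrite formE; under [leRHS]eq_bigr do rewrite -EFinM.
    by rewrite sumEFin lee_fin; exact: expR_convex_sum.
rewrite ge0_integral_sum//; last 2 first.
- by move=> i; apply: emeasurable_funM => //; exact/measurable_EFinP.
- by move=> i w _; rewrite -EFinM lee_fin mulr_ge0 ?expR_ge0.
set B := expR _.
apply: (@le_trans _ _ (\sum_i (pi i * B)%:E)%E); last first.
  by rewrite sumEFin -mulr_suml pi1 mul1r.
apply: lee_sum => i _; rewrite ge0_integralZl//; last 2 first.
- exact/measurable_EFinP.
- by rewrite lee_fin.
have [ti|ti] := eqVneq (t i) 0.
  by rewrite /pi ti mulr0 mul0r !mul0e mul0r.
rewrite (EFinM (pi i) B); apply: lee_wpmul2l; first by rewrite lee_fin.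
have := gaussian_expR_square (measurable_dotv (v i) mX) (Qpos (v i)) (law (v i)) (a := a * tau / t i).
by rewrite -/(t i) divfK//; apply.
Qed.

End GaussianVectors.

Section NoiseStep.
Context {d : measure_display} {T : measurableType d} {R : realType}.
Variables (P : probability T R) (p : nat) (X : T -> 'cV[R]_p) (eta : R).
Hypothesis eta0 : 0 < eta.
Hypothesis gX : centered_gaussian_vector P X (eta *: 1%:M).

Lemma dotv_isotropic (u : 'cV[R]_p) :
  dotv u ((eta *: 1%:M) *m u) = eta * dotv u u.
Proof. by rewrite -scalemxAl mul1mx dotvZr. Qed.

(** The cross term between the state and the noise is separated from the square of
  the noise by the inequality [2 exp (u + v) <= exp (2 u + t) + exp (2 v - t)]. The
  cross term is Gaussian with variance proportional to the squared length of the
  gradient, hence at most the trace times the form, which gives the factor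
  [1 + 4 s eta N]. *)
Lemma gaussian_step_expR_wform m (c : 'I_m -> R) v s (y : 'cV[R]_p) :
  let N := \sum_i c i * dotv (v i) (v i) in
  (forall i, 0 <= c i) -> `|2 * s * (eta * N)| <= 1 / 4 ->
  (\int[P]_w (expR (s * wform c v (y + X w)))%:E <=
   (expR (s * (1 + 4 * s * eta * N) * wform c v y +
          s * (eta * N) + 8 * (s * (eta * N)) ^+ 2))%:E)%E.
Proof.
move=> N c0 sN; have [mX _ _ _] := gX.
set q := wform c v y; set z := wgrad c v y.
have NE : wtrace c v (eta *: 1%:M) = eta * N.
  by rewrite /wtrace /N mulr_sumr; apply: eq_bigr => i _; rewrite dotv_isotropic mulrCA.
have Xdef (u : 'cV[R]_p) : dotv u ((eta *: 1%:M) *m u) = 0 -> u = 0.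
  by rewrite dotv_isotropic => /eqP; rewrite mulf_eq0 gt_eqF//= => /eqP /dotv_eq0.
pose a := 8 * s ^+ 2 * eta * dotv z z.
pose b := 2 * s * (eta * N) + 4 * (2 * s * (eta * N)) ^+ 2.
(* The value of [t] for which the two exponential moments contribute equally. *)
pose t := (b - a) / 2.
have linE : (\int[P]_w (expR (dotv (4 * s *: z) (X w)))%:E = (expR a)%:E)%E.
  rewrite (gaussian_vector_expR_dotv gX) dotv_isotropic dotvZl dotvZr /a.
  by congr (expR _)%:E; field.
have quadE : (\int[P]_w (expR (2 * s * wform c v (X w)))%:E <= (expR b)%:E)%E.
  by rewrite /b -NE; apply: (gaussian_vector_expR_wform gX) => //; rewrite NE.
have m1 : measurable_fun setT (fun w => expR (dotv (4 * s *: z) (X w))).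
  by apply: measurableT_comp => //; exact: measurable_dotv.
have m2 : measurable_fun setT (fun w => expR (2 * s * wform c v (X w))).
  by apply: measurableT_comp => //; apply: measurable_funM => //; exact: measurable_wform.
have K0 : 0 <= expR (s * q) / 2 by rewrite divr_ge0 ?expR_ge0.
apply: (@le_trans _ _ (\int[P]_w ((expR (s * q) / 2 * expR t)%:E *
    (expR (dotv (4 * s *: z) (X w)))%:E +
    (expR (s * q) / 2 * expR (- t))%:E * (expR (2 * s * wform c v (X w)))%:E))%E).
  apply: ge0_le_integral => //.
  - apply/measurable_EFinP; apply: measurableT_comp => //.
    apply: measurable_funM => //; apply: measurable_wform => i.
    by under eq_fun do rewrite mxE; exact: measurable_funD.
  - apply: emeasurable_funD; apply: emeasurable_funM => //; exact/measurable_EFinP.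
  - move=> w _; rewrite -!EFinM -EFinD lee_fin.
    rewrite wformD -/q -/z !mulrDr expRD expRD -!mulrA -mulrDr ler_wpM2l ?expR_ge0//.
    rewrite dotvZl.
    set A := s * (2 * dotv z (X w)); set B := s * wform c v (X w).
    have -> : 4 * s * dotv z (X w) = A + A by rewrite /A; ring.
    have -> : 2 * (s * wform c v (X w)) = B + B by rewrite /B; ring.
    have := sqr_ge0 (expR (t / 2) * expR A - expR (- (t / 2)) * expR B).
    have E1 : expR t = expR (t / 2) * expR (t / 2) by rewrite -expRD; congr expR; field.
    have E2 : expR (- t) = expR (- (t / 2)) * expR (- (t / 2)).
      by rewrite -expRD; congr expR; field.
    have E3 : expR (t / 2) * expR (- (t / 2)) = 1 by rewrite -expRD subrr expR0.
    rewrite !expRD E1 E2.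
    set e := expR (t / 2) in E3 *; set e' := expR (- (t / 2)) in E3 *.
    have -> : (e * expR A - e' * expR B) ^+ 2 =
      e * e * (expR A * expR A) + e' * e' * (expR B * expR B)
       - 2 * (e * e') * (expR A * expR B) by ring.
    by rewrite E3; lra.
rewrite ge0_integralD//; last 2 first.
- by apply: emeasurable_funM => //; exact/measurable_EFinP.
- by apply: emeasurable_funM => //; exact/measurable_EFinP.
rewrite !ge0_integralZl//; last 2 first.
- exact/measurable_EFinP.
- exact/measurable_EFinP.
rewrite linE; set Z := _ + 8 * (s * (eta * N)) ^+ 2.
apply: (@le_trans _ _ ((expR (s * q) / 2 * expR t)%:E * (expR a)%:E +
  (expR (s * q) / 2 * expR (- t))%:E * (expR b)%:E)%E).
  by rewrite leeD2l// lee_wpmul2l// lee_fin mulr_ge0// expR_ge0.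
rewrite -!EFinM -EFinD lee_fin -!mulrA -!expRD -mulrDr.
have -> : t + a = (a + b) / 2 by rewrite /t; field.
have -> : - t + b = (a + b) / 2 by rewrite /t; field.
rewrite -mulrDr.
have -> : 2^-1 * (expR ((a + b) / 2) + expR ((a + b) / 2)) = expR ((a + b) / 2) by field.
rewrite -expRD ler_expR.
have zz : s ^+ 2 * eta * dotv z z <= s ^+ 2 * eta * (N * q).
  apply: ler_wpM2l; last exact: wgrad_le.
  by rewrite mulr_ge0 ?sqr_ge0 ?(ltW eta0).
rewrite /a /b /Z; move: zz.
have -> : s * (1 + 4 * s * eta * N) * q = s * q + 4 * (s ^+ 2 * eta * (N * q)) by ring.
set u := s ^+ 2 * eta * dotv z z.
have -> : 8 * s ^+ 2 * eta * dotv z z = 8 * u by rewrite /u; ring.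
set r := s * (eta * N).
have -> : 2 * s * (eta * N) = 2 * r by rewrite /r; ring.
have -> : (2 * r) ^+ 2 = 4 * r ^+ 2 by ring.
set r2 := r ^+ 2; set u2 := s ^+ 2 * eta * (N * q).
lra.
Qed.

End NoiseStep.

(** * Stationary covariance and adjoint orbits *)

Section StationaryCovariance.
Context {R : realType}.
Variables (p : nat) (eta : R) (A Q : 'M[R]_p).

Definition transition : 'M[R]_p := 1%:M + eta *: A.
Local Notation F := transition.
Local Notation D := (contraction_rate eta A).

Hypothesis eta0 : 0 < eta.
Hypothesis D0 : 0 < D.
Hypothesis Qsym : Q^T = Q.
Hypothesis Qpos : forall u : 'cV[R]_p, 0 <= dotv u (Q *m u).
Hypothesis Qeq : A *m Q + Q *m A^T + eta *: (A *m Q *m A^T) + 1%:M = 0.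

Lemma etaD_sigma : eta * D = 1 - sigma_max F.
Proof. by rewrite /contraction_rate mulrC divfK ?gt_eqF. Qed.

Lemma etaD_gt0 : 0 < eta * D. Proof. exact: mulr_gt0. Qed.

Lemma etaD_le1 : eta * D <= 1.
Proof. by rewrite etaD_sigma gerBl sigma_max_ge0. Qed.

(** The transpose has the same operator norm [1 - eta D]; the square of this number
  is bounded by the number itself. *)
Lemma transition_tr_contraction u :
  dotv (F^T *m u) (F^T *m u) <= (1 - eta * D) * dotv u u.
Proof.
set y := F^T *m u; set s := 1 - eta * D.
have s0 : 0 <= s by rewrite subr_ge0 etaD_le1.
have s1 : s <= 1 by rewrite gerBl ltW// etaD_gt0.
have sE : s = sigma_max F by rewrite /s etaD_sigma subKr.
suff h : dotv y y <= s ^+ 2 * dotv u u.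
  apply: le_trans h _; apply: ler_wpM2r; first exact: dotv_ge0.
  by rewrite expr2 ler_piMr.
have [->|y0] := eqVneq (dotv y y) 0.
  by rewrite mulr_ge0 ?sqr_ge0// dotv_ge0.
have yy : 0 < dotv y y by rewrite lt0r y0 dotv_ge0.
rewrite -(ler_pM2r yy) -expr2.
rewrite {1}(_ : dotv y y = dotv u (F *m y)); last by rewrite dotv_mulmx.
apply: le_trans (cauchy_schwarz_dotv _ _) _.
rewrite [s ^+ 2 * _]mulrC -mulrA ler_wpM2l ?dotv_ge0// sE.
exact: sigma_max_ge.
Qed.

(** The stationarity equation says that [Q = F *m Q *m F^T + eta *: 1%:M]. *)
Lemma covariance_step u :
  dotv u (Q *m u) = dotv (F^T *m u) (Q *m (F^T *m u)) + eta * dotv u u.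
Proof.
have QE : Q = F *m Q *m F^T + eta *: 1%:M.
  have -> : F^T = 1%:M + eta *: A^T by rewrite /F linearD linearZ /= tr_scalar_mx.
  rewrite /F mulmxDr mulmx1 !mulmxDl mul1mx -!scalemxAr -!scalemxAl scalerA.
  have := congr1 (fun M => Q + eta *: M) Qeq.
  by rewrite scaler0 addr0 !scalerDr !scalerA !addrA => ->.
rewrite {1}QE mulmxDl dotvDr -scalemxAl mul1mx dotvZr; congr (_ + _).
by rewrite -!mulmxA dotv_mulmx.
Qed.

Lemma covariance_definite u : dotv u (Q *m u) = 0 -> u = 0.
Proof.
rewrite covariance_step => /eqP; rewrite paddr_eq0 ?Qpos//; last first.
  by rewrite mulr_ge0 ?dotv_ge0// (ltW eta0).
by rewrite mulf_eq0 (gt_eqF eta0)/= => /andP[_ /eqP/dotv_eq0].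
Qed.

(** At a maximizer of the form on the sphere, the recursion of the covariance
  bounds the maximum by itself, contracted. *)
Lemma covariance_le u : dotv u (Q *m u) <= dotv u u / D.
Proof.
have [p0|p0] := posnP p.
  have -> : u = 0 by apply/colP => i; have := ltn_ord i; rewrite [X in (_ < X)%N]p0.
  by rewrite !dotv0l mul0r.
have NQsym : (- Q)^T = - Q by rewrite linearN /= Qsym.
have [a [v [v1 Qv amin]]] := rayleigh_min p0 NQsym.
have amax y : dotv y (Q *m y) <= - a * dotv y y.
  by have := amin y; rewrite mulNmx dotvNr; lra.
have vQ : dotv v (Q *m v) = - a.
  have : dotv v (- Q *m v) = a by rewrite Qv dotvZr v1 mulr1.
  by rewrite mulNmx dotvNr; lra.
have a0 : 0 <= - a by rewrite -vQ.
have := amax (F^T *m v); have := transition_tr_contraction v.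
have := covariance_step v; rewrite vQ v1 !mulr1 => E h1 h2.
have h3 : - a * dotv (F^T *m v) (F^T *m v) <= - a * (1 - eta * D) by rewrite ler_wpM2l.
have h4 : - a * (eta * D) <= eta.
  move: h3; rewrite mulrBr mulr1 => h3; lra.
have h5 : - a <= D^-1.
  rewrite -(ler_pM2r etaD_gt0) (le_trans h4)// mulrCA mulVf ?mulr1//.
  by rewrite gt_eqF.
apply: le_trans (amax u) _; rewrite [leLHS]mulrC.
by apply: ler_wpM2l => //; exact: dotv_ge0.
Qed.

Definition adjoint_orbit (u : 'cV[R]_p) (k : nat) : 'cV[R]_p :=
  iter k (mulmx F^T) u.

Definition orbit_energy (kap : R) (u : 'cV[R]_p) (m : nat) : R :=
  \sum_(k < m) kap ^+ k * dotv (adjoint_orbit u k) (adjoint_orbit u k).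

Lemma orbit_energyS kap u m : orbit_energy kap u m.+1 =
  dotv u u + kap * orbit_energy kap (F^T *m u) m.
Proof.
rewrite /orbit_energy big_ord_recl expr0 mul1r; congr (_ + _).
rewrite mulr_sumr; apply: eq_bigr => k _.
by rewrite exprS -mulrA /adjoint_orbit -iterSr.
Qed.

Lemma orbit_energy_ge0 kap u m : 0 <= kap -> 0 <= orbit_energy kap u m.
Proof.
by move=> kap0; apply: sumr_ge0 => k _; rewrite mulr_ge0 ?exprn_ge0// dotv_ge0.
Qed.

Lemma orbit_energy_le kap del u m : 0 <= kap -> 0 < del ->
  kap * (1 - eta * D) <= 1 - del ->
  orbit_energy kap u m <= dotv u u / del.
Proof.
move=> kap0 del0 kdel; elim: m u => [|m IHm] u.
  by rewrite /orbit_energy big_ord0 divr_ge0 ?dotv_ge0 ?(ltW del0).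
rewrite orbit_energyS ler_pdivlMr// mulrDl.
have h1 : orbit_energy kap (F^T *m u) m * del <= (1 - eta * D) * dotv u u.
  by rewrite -ler_pdivlMr// (le_trans (IHm _))// ler_pM2r ?invr_gt0// transition_tr_contraction.
have h2 : kap * (orbit_energy kap (F^T *m u) m * del) <=
  kap * ((1 - eta * D) * dotv u u) by rewrite ler_wpM2l.
have h3 : kap * ((1 - eta * D) * dotv u u) <= (1 - del) * dotv u u.
  by rewrite mulrA ler_wpM2r// dotv_ge0.
rewrite -mulrA; apply: le_trans (lerD (lexx _) (le_trans h2 h3)) _.
by rewrite mulrBl mul1r [_ * del]mulrC addrC subrK.
Qed.

(** Without the factor [kap], [eta] times the energy of the whole orbit is the
  stationary variance of [dotv u x]; the next two lemmas measure the effect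
  of [kap] and of truncating the orbit. *)
Lemma orbit_energy_mean_le kap del u m : 1 <= kap -> 0 < del ->
  kap * (1 - eta * D) <= 1 - del ->
  eta * orbit_energy kap u m <=
  dotv u (Q *m u) + (kap - 1) / (D * del) * dotv u u.
Proof.
move=> kap1 del0 kdel; set c := (kap - 1) / (D * del).
have c0 : 0 <= c by apply: divr_ge0; [rewrite subr_ge0|apply: mulr_ge0; exact: ltW].
elim: m u => [|m IHm] u.
  by rewrite /orbit_energy big_ord0 mulr0 addr_ge0// mulr_ge0 ?dotv_ge0.
rewrite orbit_energyS mulrDr mulrCA.
have kap0 : 0 <= kap by lra.
have h1 := ler_wpM2l kap0 (IHm (F^T *m u)).
have h2 := covariance_step u.
have h3 := covariance_le (F^T *m u).
have h4 := transition_tr_contraction u.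
set v1 := F^T *m u in h1 h2 h3 h4 *.
have u0 := dotv_ge0 u.
have h5 : dotv v1 v1 <= dotv u u.
  by apply: le_trans h4 _; rewrite ler_piMl// gerBl ltW// etaD_gt0.
have h6 : (kap - 1) * dotv v1 (Q *m v1) <= c * del * dotv u u.
  have -> : c * del = (kap - 1) / D by rewrite /c; field; rewrite !gt_eqF.
  rewrite -mulrA ler_wpM2l ?subr_ge0// (le_trans h3)// mulrC ler_wpM2l//.
  by rewrite invr_ge0 ltW.
have h7 : kap * (c * dotv v1 v1) <= c * ((1 - del) * dotv u u).
  rewrite mulrCA ler_wpM2l//; apply: (@le_trans _ _ (kap * ((1 - eta * D) * dotv u u))).
    by rewrite ler_wpM2l.
  by rewrite mulrA ler_wpM2r.
move: h1 h6 h7; rewrite h2 mulrDr mulrBl mul1r.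
have -> : c * ((1 - del) * dotv u u) = c * dotv u u - c * del * dotv u u by ring.
lra.
Qed.

Lemma orbit_energy_mean_ge kap u n : 0 <= kap <= 1 ->
  n%:R * dotv u (Q *m u) - eta * \sum_(m < n) orbit_energy kap u m <=
  (n%:R * (1 - kap) + 1) / (eta * D ^+ 2) * dotv u u.
Proof.
move=> /andP[kap0 kap1].
(* The truncation error starts from the whole variance and contracts, while each
   step adds the effect of [kap]. *)
pose c := fix c m : R := if m is m'.+1 then (1 - kap) / D + (1 - eta * D) * c m' else D^-1.
have s0 : 0 <= 1 - eta * D by rewrite subr_ge0 etaD_le1.
have c0 m : 0 <= c m.
  elim: m => [|m IHm] /=; first by rewrite invr_ge0 ltW.
  by rewrite addr_ge0 ?mulr_ge0// ?subr_ge0// invr_ge0 ltW.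
have csum m : eta * D * \sum_(i < m) c i + c m = m%:R * (1 - kap) / D + D^-1.
  elim: m => [|m IHm]; first by rewrite big_ord0 mulr0 !mul0r.
  have -> : c m.+1 = (1 - kap) / D + (1 - eta * D) * c m by [].
  rewrite big_ord_recr /= mulrDr -[m.+1]addn1 natrD.
  have -> : (1 - eta * D) * c m = c m - eta * D * c m by rewrite mulrBl mul1r.
  move: IHm; set X := eta * D * _; set Y := eta * D * c m; move=> IHm.
  have -> : (m%:R + 1%:R) * (1 - kap) / D + D^-1 = (X + c m) + (1 - kap) / D.
    by rewrite IHm; ring.
  by ring.
have bound m v : dotv v (Q *m v) - eta * orbit_energy kap v m <= c m * dotv v v.
  elim: m v => [|m IHm] v.
    by rewrite /orbit_energy big_ord0 mulr0 subr0 mulrC; exact: covariance_le.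
  rewrite orbit_energyS covariance_step.
  have h1 := ler_wpM2l kap0 (IHm (F^T *m v)).
  have h3 := covariance_le (F^T *m v).
  have h4 := transition_tr_contraction v.
  set v1 := F^T *m v in h1 h3 h4 *.
  have v0 := dotv_ge0 v; have v10 := dotv_ge0 v1.
  have h5 : dotv v1 v1 <= dotv v v.
    by apply: le_trans h4 _; rewrite ler_piMl// gerBl ltW// etaD_gt0.
  have h6 : (1 - kap) * dotv v1 (Q *m v1) <= (1 - kap) / D * dotv v v.
    rewrite -mulrA ler_wpM2l ?subr_ge0// (le_trans h3)// mulrC ler_wpM2l//.
    by rewrite invr_ge0 ltW.
  have h7 : kap * (c m * dotv v1 v1) <= (1 - eta * D) * c m * dotv v v.
    apply: (@le_trans _ _ (c m * dotv v1 v1)).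
      by rewrite ler_piMl// mulr_ge0.
    by rewrite [(1 - _) * _]mulrC -mulrA ler_wpM2l.
  rewrite [leRHS]mulrDl -/(c m).
  set q1 := dotv v1 (Q *m v1) in h1 h3 h6 *; set E := orbit_energy kap v1 m in h1 *.
  have -> : q1 + eta * dotv v v - eta * (dotv v v + kap * E) =
      (1 - kap) * q1 + kap * (q1 - eta * E) by ring.
  exact: lerD h6 (le_trans h1 h7).
have -> : n%:R * dotv u (Q *m u) - eta * \sum_(m < n) orbit_energy kap u m =
    \sum_(m < n) (dotv u (Q *m u) - eta * orbit_energy kap u m).
  by rewrite sumrB sumr_const card_ord mulr_natl mulr_sumr.
apply: (@le_trans _ _ (\sum_(m < n) c m * dotv u u)); first exact: ler_sum.
rewrite -mulr_suml ler_wpM2r ?dotv_ge0//.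
rewrite ler_pdivlMr; last by rewrite mulr_gt0// exprn_gt0.
have -> : (\sum_(i < n) c i) * (eta * D ^+ 2) = (eta * D * \sum_(i < n) c i) * D by ring.
have := csum n; have := c0 n => h1 h2.
have : (eta * D * \sum_(i < n) c i) <= n%:R * (1 - kap) / D + D^-1 by lra.
move/(ler_wpM2r (ltW D0))/le_trans; apply.
rewrite mulrDl divfK ?gt_eqF// mulVf ?gt_eqF//.
Qed.

End StationaryCovariance.

(** * Concentration of the empirical second moments *)

Section Process.
Context {d : measure_display} {T : measurableType d} {R : realType}.
Variables (P : probability T R) (p : nat) (eta : R) (A Q : 'M[R]_p)
  (x w : nat -> T -> 'cV[R]_p).
Hypothesis eta0 : 0 < eta.
Hypothesis D0 : 0 < contraction_rate eta A.
Hypothesis process : stationary_process P eta A Q x w.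
Local Notation F := (transition eta A).
Local Notation D := (contraction_rate eta A).
Local Notation pastT t := (g_sigma_algebraType (past x w t)).
Local Notation noiseT t := (g_sigma_algebraType (noise w t)).

Lemma state_step t omega : x t.+1 omega = F *m x t omega + w t.+1 omega.
Proof.
by rewrite (recursion process) /transition mulmxDl mul1mx -scalemxAl.
Qed.

Lemma measurable_driver t i :
  measurable_fun setT (fun omega => driver x w t omega i 0).
Proof.
case: t => [|t] /=.
  by have [] := initial_gaussian process.
by have [] := noise_gaussian process t.
Qed.

Lemma measurable_mulmx (d' : measure_display) (T' : measurableType d')
    (M : 'M[R]_p) (Y : T' -> 'cV[R]_p) i :
  (forall j, measurable_fun setT (fun omega => Y omega j 0)) ->
  measurable_fun setT (fun omega => (M *m Y omega) i 0).
Proof.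
move=> mY; under eq_fun do rewrite mxE.
by apply: measurable_sum => j; exact: measurable_funM.
Qed.

Lemma measurable_state_past s t i : (s <= t)%N ->
  measurable_fun setT (fun omega : pastT t => x s omega i 0).
Proof.
elim: s i => [|s IHs] i st; first exact: (measurable_driver_past (s := 0)).
under eq_fun do rewrite state_step mxE; apply: measurable_funD.
  by apply: measurable_mulmx => j; exact: IHs (ltnW st).
exact: (measurable_driver_past (s := s.+1)).
Qed.

Lemma measurable_past_fun t (f : T -> R) :
  measurable_fun setT (f : pastT t -> R) -> measurable_fun setT f.
Proof.
move=> mf; exact: (measurableT_comp mf
  (@measurable_id_past _ _ _ _ _ _ measurable_driver t)).
Qed.

Lemma measurable_state t i : measurable_fun setT (fun omega => x t omega i 0).
Proof. by apply: (@measurable_past_fun t); exact: measurable_state_past. Qed.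

Lemma freeze_past_le t (phi : T -> T -> R) (psi : T -> R) :
  measurable_fun setT (fun z : (pastT t * noiseT t.+1)%type => phi z.1 z.2) ->
  measurable_fun setT (psi : pastT t -> R) ->
  (forall a b, 0 <= phi a b) ->
  (forall a, (\int[P]_b (phi a b)%:E <= (psi a)%:E)%E) ->
  (\int[P]_a (phi a a)%:E <= \int[P]_a (psi a)%:E)%E.
Proof.
apply: expectation_freeze_past_le; first exact: measurable_driver.
- exact: noise_independent process.
- exact: initial_independent process.
Qed.

Lemma measurable_noise_pair t i :
  measurable_fun setT (fun z : (pastT t * noiseT t.+1)%type => w t.+1 z.2 i 0).
Proof.
exact: (measurableT_comp (@measurable_noise _ _ _ _ w t.+1 i) measurable_snd).
Qed.

Lemma measurable_past_pair t (f : T -> R) :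
  measurable_fun setT (f : pastT t -> R) ->
  measurable_fun setT (fun z : (pastT t * noiseT t.+1)%type => f z.1).
Proof.
by move=> mf; exact: (measurableT_comp mf measurable_fst).
Qed.

Lemma state_expR_step t (U : T -> R) m (c : 'I_m -> R) v s :
  let N := \sum_i c i * dotv (v i) (v i) in
  measurable_fun setT (U : pastT t -> R) -> (forall a, 0 <= U a) ->
  (forall i, 0 <= c i) -> `|2 * s * (eta * N)| <= 1 / 4 ->
  (\int[P]_a (U a * expR (s * wform c v (x t.+1 a)))%:E <=
   \int[P]_a (U a * expR (s * (1 + 4 * s * eta * N) * wform c v (F *m x t a) +
     s * (eta * N) + 8 * (s * (eta * N)) ^+ 2))%:E)%E.
Proof.
move=> N mU U0 c0 sN.
pose phi a b := U a * expR (s * wform c v (F *m x t a + w t.+1 b)).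
have -> : (\int[P]_a (U a * expR (s * wform c v (x t.+1 a)))%:E =
    \int[P]_a (phi a a)%:E)%E.
  by apply: eq_integral => a _; rewrite /phi state_step.
have mx i : measurable_fun setT (fun a : pastT t => x t a i 0).
  exact: measurable_state_past.
apply: (@freeze_past_le t).
- apply: measurable_funM; first exact: measurable_past_pair.
  apply: measurableT_comp => //; apply: measurable_funM => //.
  apply: measurable_wform => i; under eq_fun do rewrite mxE.
  apply: measurable_funD; last exact: measurable_noise_pair.
  apply: (@measurable_past_pair t (fun a => (F *m x t a) i 0)).
  exact: measurable_mulmx.
- apply: measurable_funM => //; apply: measurableT_comp => //.
  apply: measurable_funD => //; apply: measurable_funD => //.
  apply: measurable_funM => //; apply: measurable_wform => i.
  exact: measurable_mulmx.
- by move=> a b; rewrite mulr_ge0 ?expR_ge0.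
- move=> a; rewrite EFinM.
  have mform : measurable_fun setT
      (fun b => expR (s * wform c v (F *m x t a + w t.+1 b))).
    apply: measurableT_comp => //; apply: measurable_funM => //.
    apply: measurable_wform => i; under eq_fun do rewrite mxE.
    by apply: measurable_funD => //; exact: (measurable_driver t.+1).
  under eq_integral do rewrite EFinM.
  rewrite ge0_integralZl ?lee_fin//; last exact/measurable_EFinP.
  apply: lee_wpmul2l; first by rewrite lee_fin.
  exact: (gaussian_step_expR_wform eta0 (noise_gaussian process t)).
Qed.

Definition orbit_form (kap : R) (u : 'cV[R]_p) (m : nat) : 'cV[R]_p -> R :=
  wform (fun k : 'I_m => kap ^+ k) (fun k : 'I_m => adjoint_orbit eta A u k).

Lemma orbit_formS kap u m y : orbit_form kap u m.+1 y =
  dotv u y ^+ 2 + kap * orbit_form kap u m (F *m y).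
Proof.
rewrite /orbit_form /wform big_ord_recl expr0 mul1r; congr (_ + _).
rewrite mulr_sumr; apply: eq_bigr => k _.
by rewrite lift0 (exprS kap) -mulrA /adjoint_orbit iterS [in RHS]dotv_mulmx.
Qed.

Definition square_sum (u : 'cV[R]_p) (t : nat) (omega : T) : R :=
  \sum_(i < t) dotv u (x i omega) ^+ 2.

Lemma measurable_square_sum_past u t :
  measurable_fun setT (square_sum u t : pastT t -> R).
Proof.
apply: measurable_sum => i; apply: measurable_funX; apply: measurable_dotv => j.
by apply: measurable_state_past; exact: ltnW.
Qed.

Lemma measurable_square_sum u t : measurable_fun setT (square_sum u t).
Proof. exact: (measurable_past_fun (@measurable_square_sum_past u t)). Qed.

(** The exponential of the sum is propagated backwards through the recursion: once
  the states after time [t] are averaged out, a quadratic form in the state at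
  time [t] remains. Each step adds the current square, pulls the form back by the
  transition and inflates it by [kap]. *)
Lemma square_sum_iterate kap Nb u s m t :
  let cost l := s * (eta * orbit_energy eta A kap u l) +
    8 * (s * (eta * orbit_energy eta A kap u l)) ^+ 2 in
  kap = 1 + 4 * s * eta * Nb -> 0 <= kap ->
  (forall l, orbit_energy eta A kap u l <= Nb) ->
  `|2 * s * (eta * Nb)| <= 1 / 4 ->
  (\int[P]_a (expR (s * square_sum u (t + m) a))%:E <=
   \int[P]_a (expR (s * square_sum u t a + s * orbit_form kap u m (x t a) +
     \sum_(l < m) cost l))%:E)%E.
Proof.
move=> cost kapE kap0 NbE sNb.
elim: m t => [|m IHm] t.
  rewrite addn0 le_eqVlt; apply/orP; left; apply/eqP.
  apply: eq_integral => a _; by rewrite /orbit_form /wform !big_ord0 mulr0 !addr0.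
rewrite addnS -addSn; apply: le_trans (IHm t.+1) _.
pose N := orbit_energy eta A kap u m.
have N0 : 0 <= N by exact: orbit_energy_ge0.
have sN : `|2 * s * (eta * N)| <= 1 / 4.
  apply: le_trans sNb; rewrite !normrM ler_wpM2l ?mulr_ge0//.
  by rewrite ler_wpM2l// (ger0_norm N0) (ger0_norm (le_trans N0 (NbE m))); exact: NbE.
pose U a := expR (s * square_sum u t.+1 a + \sum_(l < m) cost l).
have mU : measurable_fun setT (U : pastT t -> R).
  apply: measurableT_comp => //; apply: measurable_funD => //.
  apply: measurable_funM => //; apply: measurable_sum => i.
  apply: measurable_funX; apply: measurable_dotv => j.
  by apply: measurable_state_past; rewrite -ltnS.
have -> : (\int[P]_a (expR (s * square_sum u t.+1 a + s * orbit_form kap u m (x t.+1 a) +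
     \sum_(l < m) cost l))%:E = \int[P]_a (U a * expR (s * orbit_form kap u m (x t.+1 a)))%:E)%E.
  by apply: eq_integral => a _; rewrite -expRD addrAC.
apply: le_trans (state_expR_step mU _ _ sN) _.
- by move=> a; exact: expR_ge0.
- by move=> i; exact: exprn_ge0.
have mx i : measurable_fun setT (fun a => x t a i 0) by exact: measurable_state.
apply: ge0_le_integral => //.
- by move=> a _; rewrite lee_fin mulr_ge0 ?expR_ge0.
- apply/measurable_EFinP; apply: measurable_funM; first exact: measurable_past_fun mU.
  apply: measurableT_comp => //.
  apply: measurable_funD => //; apply: measurable_funD => //.
  apply: measurable_funM => //; apply: measurable_wform => i.
  exact: measurable_mulmx.
- apply/measurable_EFinP; apply: measurableT_comp => //.
  apply: measurable_funD => //; apply: measurable_funD => //.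
    by apply: measurable_funM => //; exact: measurable_square_sum.
  by apply: measurable_funM => //; exact: measurable_wform.
- move=> a _; rewrite lee_fin -expRD ler_expR.
  rewrite big_ord_recr /= orbit_formS {1}/square_sum big_ord_recr /= -/(square_sum u t a).
  rewrite -/(orbit_form kap u m (F *m x t a)) -/N.
  set q := orbit_form kap u m _; set y := dotv u _ ^+ 2.
  have q0 : 0 <= q by apply: wform_ge0 => i; exact: exprn_ge0.
  have sq : s * (1 + 4 * s * eta * N) * q <= s * (kap * q).
    have -> : s * (1 + 4 * s * eta * N) * q = s * q + 4 * s ^+ 2 * eta * q * N by ring.
    have -> : s * (kap * q) = s * q + 4 * s ^+ 2 * eta * q * Nb by rewrite kapE; ring.
    rewrite lerD2l; apply: ler_wpM2l; last exact: NbE.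
    by apply: mulr_ge0 => //; apply: mulr_ge0 (ltW eta0); rewrite mulr_ge0 ?sqr_ge0.
  rewrite /cost -/N mulrDr [s * (y + _)]mulrDr.
  move: sq; set z := s * square_sum u t a; set c := \sum_(l < m) _.
  rewrite -[X in s * (1 + 4 * s * eta * X)]/N.
  set c1 := s * (eta * N); lra.
Qed.

Let Qpos : forall u : 'cV[R]_p, 0 <= dotv u (Q *m u).
Proof. by have [] := initial_gaussian process. Qed.

Let Qsym : Q^T = Q.
Proof. by have [] := initial_gaussian process. Qed.

Let Qeq := stationary_covariance process.

(** The parameters: [6 / (5 eta D)] bounds the energy of the inflated orbits, for
  which [s] has to be small against [eta D^2]. The inflation and the square of the
  noise contribute at most [6] and [12] to the constant [18]; the term [1 / 10]
  covers the initial state and the truncation of the orbit at time [n]. *)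
Lemma square_sum_mgf u s n :
  dotv u u = 1 -> `|s| <= eta * D ^+ 2 / 100 ->
  (\int[P]_a (expR (s * square_sum u n a))%:E <=
   (expR (s * (n%:R * dotv u (Q *m u)) + 18 * (n%:R * (s ^+ 2 / (eta * D ^+ 3))) + 1 / 10))%:E)%E.
Proof.
move=> u1 sle.
pose h := eta * D; have h0 : 0 < h by exact: etaD_gt0.
have h1 : h <= 1 by exact: etaD_le1.
pose r := s / D.
have rle : `|r| <= h / 100.
  rewrite /r normrM normfV (gtr0_norm D0) ler_pdivrMr// (le_trans sle)//.
  by rewrite /h le_eqVlt; apply/orP; left; apply/eqP; field.
have [r1 r2] : - (h / 100) <= r /\ r <= h / 100 by apply/andP; rewrite -ler_norml.
pose del := 5 / 6 * h; have del0 : 0 < del by rewrite mulr_gt0.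
pose Nb := 6 / 5 / h.
have etaNb : s * (eta * Nb) = 6 / 5 * r by rewrite /Nb /h /r; field; rewrite !gt_eqF.
pose kap := 1 + 4 * s * eta * Nb.
have kapE : kap = 1 + 24 / 5 * r.
  have -> : 24 / 5 * r = 4 * (6 / 5 * r) by field.
  by rewrite -etaNb /kap; ring.
have kap0 : 0 <= kap by rewrite kapE; lra.
have kapdel : kap * (1 - eta * D) <= 1 - del.
  rewrite -/h /del kapE.
  have : 24 / 5 * r * (1 - h) <= 24 / 5 * (h / 100) * (1 - h).
    by rewrite ler_wpM2r ?subr_ge0// ler_wpM2l.
  have : 0 <= h * h by rewrite mulr_ge0// ltW.
  lra.
have NbE l : orbit_energy eta A kap u l <= Nb.
  apply: le_trans (orbit_energy_le eta0 D0 u l kap0 del0 kapdel) _.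
  by rewrite u1 /Nb /del le_eqVlt; apply/orP; left; apply/eqP; field; rewrite gt_eqF.
have sNb : `|2 * s * (eta * Nb)| <= 1 / 4.
  have -> : 2 * s * (eta * Nb) = 12 / 5 * r by rewrite -mulrA etaNb; field.
  by rewrite ler_norml; apply/andP; split; lra.
pose E l := orbit_energy eta A kap u l.
have E0 l : 0 <= E l by exact: orbit_energy_ge0.
have sE l : `|s * (eta * E l)| <= 6 / 5 * `|r|.
  have absE z : 0 <= z -> `|s * (eta * z)| = `|s| * (eta * z).
    by move=> z0; rewrite normrM (@ger0_norm _ (eta * z))// mulr_ge0// ltW.
  have -> : 6 / 5 * `|r| = `|s * (eta * Nb)| by rewrite etaNb (normrM (6 / 5)) (@ger0_norm _ (6 / 5)).
  rewrite !absE//; last exact: le_trans (E0 l) (NbE l).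
  by apply: ler_wpM2l => //; apply: ler_wpM2l (NbE l); exact: ltW.
have sE2 l : 8 * (s * (eta * E l)) ^+ 2 <= 12 * (r ^+ 2 / h).
  have : (s * (eta * E l)) ^+ 2 <= (6 / 5 * `|r|) ^+ 2.
    by rewrite -real_normK ?num_real// ler_pXn2r ?nnegrE// mulr_ge0.
  have -> : (6 / 5 * `|r|) ^+ 2 = 36 / 25 * r ^+ 2.
    by rewrite -[r ^+ 2]real_normK ?num_real//; field.
  have : r ^+ 2 <= r ^+ 2 / h by rewrite ler_pdivlMr// ler_piMr// sqr_ge0.
  set z := r ^+ 2 / h; set z2 := r ^+ 2; have : 0 <= z2 by exact: sqr_ge0.
  lra.
have rsE : r ^+ 2 / h = s ^+ 2 / (eta * D ^+ 3).
  by rewrite /r /h; field; rewrite !gt_eqF.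
set tau := dotv u (Q *m u).
pose B := s * (n%:R * tau) + 18 * (n%:R * (r ^+ 2 / h)) + 1 / 50.
have cost_le : \sum_(l < n) (s * (eta * E l) + 8 * (s * (eta * E l)) ^+ 2) <= B.
  rewrite big_split /=.
  have sq : \sum_(l < n) 8 * (s * (eta * E l)) ^+ 2 <= n%:R * (12 * (r ^+ 2 / h)).
    apply: (@le_trans _ _ (\sum_(l < n) 12 * (r ^+ 2 / h))); first exact: ler_sum.
    by rewrite sumr_const card_ord -[leLHS]mulr_natl.
  suff lin : \sum_(l < n) s * (eta * E l) <=
      s * (n%:R * tau) + n%:R * (6 * (r ^+ 2 / h)) + 1 / 50.
    apply: le_trans (lerD lin sq) _; rewrite /B.
    set a1 := s * _; set a2 := r ^+ 2 / h.
    have -> : n%:R * (6 * a2) = 6 * (n%:R * a2) by ring.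
    have -> : n%:R * (12 * a2) = 12 * (n%:R * a2) by ring.
    by set a3 := n%:R * a2; lra.
  have nr0 : 0 <= n%:R * (r ^+ 2 / h) by rewrite mulr_ge0// divr_ge0 ?sqr_ge0// ltW.
  have [s0|s0] := lerP 0 s.
    have kap1 : 1 <= kap by rewrite kapE lerDl mulr_ge0// divr_ge0// ltW.
    have El l : s * (eta * E l) <= s * tau + 6 * (r ^+ 2 / h).
      have := orbit_energy_mean_le eta0 D0 Qsym Qpos Qeq u l kap1 del0 kapdel.
      move/(ler_wpM2l s0)/le_trans; apply; rewrite u1 mulr1 mulrDr lerD2l.
      have -> : s * ((kap - 1) / (D * del)) = 144 / 25 * (r ^+ 2 / h).
        by rewrite kapE /del /r /h; field; rewrite !gt_eqF.
      by rewrite ler_wpM2r ?divr_ge0 ?sqr_ge0 ?(ltW h0)//; lra.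
    apply: (@le_trans _ _ (\sum_(l < n) (s * tau + 6 * (r ^+ 2 / h)))); first exact: ler_sum.
    rewrite sumr_const card_ord -[leLHS]mulr_natl mulrDr [n%:R * (s * _)]mulrCA.
    by rewrite lerDl; lra.
  have kap01 : 0 <= kap <= 1.
    by rewrite kap0 kapE gerDl pmulr_rle0// /r pmulr_lle0 ?invr_gt0// ltW.
  have := orbit_energy_mean_ge eta0 D0 Qsym Qpos Qeq u n kap01.
  rewrite u1 mulr1 -/tau; set W := _ / (eta * D ^+ 2) => hW.
  have NsW : - s * (n%:R * tau - eta * \sum_(l < n) E l) <= - s * W.
    by apply: ler_wpM2l hW; rewrite oppr_ge0 ltW.
  have sW : - s * W = 24 / 5 * (n%:R * (r ^+ 2 / h)) - r / h.
    by rewrite /W kapE /r /h; field; rewrite !gt_eqF.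
  have rh : - (r / h) <= 1 / 100.
    by rewrite -mulNr ler_pdivrMr//; lra.
  have -> : \sum_(l < n) s * (eta * E l) = s * (eta * \sum_(l < n) E l).
    by rewrite !mulr_sumr.
  have -> : n%:R * (6 * (r ^+ 2 / h)) = 6 * (n%:R * (r ^+ 2 / h)) by ring.
  move: NsW; rewrite sW mulNr mulrBr; move: nr0 rh.
  set a1 := s * _; set a2 := s * _; set a3 := n%:R * _; set a4 := r / h.
  lra.
have start_le : (\int[P]_a (expR (s * orbit_form kap u n (x 0 a)))%:E <= (expR (1 / 50))%:E)%E.
  have ck k : 0 <= kap ^+ k by exact: exprn_ge0.
  have mform : measurable_fun setT (fun a => expR (s * orbit_form kap u n (x 0 a))).
    apply: measurableT_comp => //; apply: measurable_funM => //.
    by apply: measurable_wform => i; exact: measurable_state.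
  have [s0|s0] := lerP 0 s.
    pose tr := wtrace (fun k : 'I_n => kap ^+ k) (fun k : 'I_n => adjoint_orbit eta A u k) Q.
    have tr0 : 0 <= tr by apply: sumr_ge0 => k _; rewrite mulr_ge0.
    have trE : tr <= E n / D.
      rewrite /E /orbit_energy mulr_suml; apply: ler_sum => k _.
      by rewrite -mulrA ler_wpM2l//; exact: covariance_le.
    have str : s * tr <= 6 / 500.
      apply: (@le_trans _ _ (s * (Nb / D))).
        by rewrite ler_wpM2l// (le_trans trE)// ler_wpM2r ?invr_ge0 ?(ltW D0)// NbE.
      have -> : s * (Nb / D) = 6 / 5 * (r / h) by rewrite /Nb /r; field; rewrite !gt_eqF.
      by have : r / h <= 1 / 100; [rewrite ler_pdivrMr//; lra|lra].
    have str0 : 0 <= s * tr by rewrite mulr_ge0.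
    apply: le_trans (gaussian_vector_expR_wform (initial_gaussian process) (a := s) _ _ _) _.
    - exact: (covariance_definite eta0 Qpos Qeq).
    - by move=> k; exact: ck.
    - by rewrite -/tr ger0_norm//; lra.
    - rewrite lee_fin ler_expR.
      have : (s * tr) ^+ 2 <= s * tr * (1 / 50) by rewrite expr2 ler_wpM2l//; lra.
      by rewrite -/tr; move: str; set z := s * tr; set z2 := z ^+ 2; lra.
  apply: (@le_trans _ _ (\int[P]_a (cst 1%E a))%E); last first.
    rewrite integral_cst//= probability_setT mule1 lee_fin.
    by rewrite -[leLHS]expR0 ler_expR.
  apply: ge0_le_integral => //.
  - exact/measurable_EFinP.
  - move=> a _; rewrite lee_fin -[leRHS]expR0 ler_expR.
    by rewrite nmulr_rle0//; exact: wform_ge0.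
have := @square_sum_iterate kap Nb u s n 0 erefl kap0 NbE sNb.
rewrite add0n => /le_trans; apply.
set K := \sum_(l < n) _ in cost_le *.
under eq_integral => a _ do rewrite {1}/square_sum big_ord0 mulr0 add0r addrC expRD EFinM.
rewrite ge0_integralZl//; last first.
  apply/measurable_EFinP; apply: measurableT_comp => //; apply: measurable_funM => //.
  by apply: measurable_wform => i; exact: measurable_state.
apply: (@le_trans _ _ ((expR B)%:E * (expR (1 / 50))%:E)%E).
  by apply: lee_pmul => //; rewrite ?lee_fin ?ler_expR ?expR_ge0//; exact: integral_ge0.
rewrite -EFinM -expRD lee_fin ler_expR /B rsE; lra.
Qed.

End Process.

(** * Tail bounds *)

Section Tails.
Context {d : measure_display} {T : measurableType d} {R : realType}.
Variables (P : probability T R) (p : nat) (eta : R) (A Q : 'M[R]_p)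
  (x w : nat -> T -> 'cV[R]_p).
Hypothesis eta0 : 0 < eta.
Hypothesis D0 : 0 < contraction_rate eta A.
Hypothesis process : stationary_process P eta A Q x w.
Local Notation D := (contraction_rate eta A).
Local Notation pastT t := (g_sigma_algebraType (past x w t)).
Local Notation noiseT t := (g_sigma_algebraType (noise w t)).

Lemma measurable_pos (f : T -> R) : measurable_fun setT f ->
  measurable [set a | 0 < f a].
Proof.
move=> mf; rewrite (_ : [set a | _] = f @^-1` `]0, +oo[%classic).
  by rewrite -[X in measurable X]setTI; exact: mf.
by apply/seteqP; split => a /=; rewrite in_itv/= andbT.
Qed.

Lemma prob_pos_le_expR (f : T -> R) B : measurable_fun setT f ->
  (\int[P]_a (expR (f a))%:E <= B)%E -> (P [set a | 0 < f a]%R <= B)%E.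
Proof.
move=> mf; apply: le_trans.
have mA := measurable_pos mf.
rewrite -[X in P X]setIT -integral_indic//.
apply: ge0_le_integral => //.
- by apply/measurable_EFinP; exact: measurable_indic.
- by apply/measurable_EFinP; exact: measurableT_comp.
- move=> a _; rewrite lee_fin indicE; case: (boolP (a \in _)) => [|_].
    by rewrite inE /= => fa; rewrite -[leLHS]expR0 ler_expR ltW.
  exact: expR_ge0.
Qed.

Lemma square_sum_dev_unit u n sg eps : dotv u u = 1 -> `|sg| = 1 ->
  0 < eps -> D * eps <= 9 / 25 ->
  (P [set a | n%:R * eps < sg * (square_sum x u n a - n%:R * dotv u (Q *m u))]%R <=
   (expR (1 / 10 - n%:R * (eta * D ^+ 3 * eps ^+ 2) / 72))%:E)%E.
Proof.
move=> u1 sg1 eps0 Deps; set tau := dotv u (Q *m u).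
(* The minimizer of [18 * (s ^+ 2 / (eta * D ^+ 3)) - s * eps]. *)
pose s := eps * (eta * D ^+ 3) / 36.
have s0 : 0 < s by rewrite /s divr_gt0// mulr_gt0// mulr_gt0// exprn_gt0.
have sle : `|sg * s| <= eta * D ^+ 2 / 100.
  rewrite normrM sg1 mul1r gtr0_norm// /s.
  have -> : eps * (eta * D ^+ 3) / 36 = eta * D ^+ 2 * (D * eps / 36) by field.
  have -> : eta * D ^+ 2 / 100 = eta * D ^+ 2 * (1 / 100) by field.
  apply: ler_wpM2l; first by rewrite mulr_ge0 ?exprn_ge0 ?(ltW D0) ?(ltW eta0).
  by move: Deps; set z := D * eps; lra.
have sg2 : sg ^+ 2 = 1 by rewrite -real_normK ?num_real// sg1 expr1n.
pose K := - (sg * s * (n%:R * tau)) - s * (n%:R * eps).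
pose f a := sg * s * square_sum x u n a + K.
have mS := measurable_square_sum process u n.
have -> : [set a | n%:R * eps < sg * (square_sum x u n a - n%:R * tau)] = [set a | 0 < f a].
  have E a : (n%:R * eps < sg * (square_sum x u n a - n%:R * tau)) = (0 < f a).
    by rewrite -(ltr_pM2l s0) -subr_gt0; congr (0 < _); rewrite /f /K; ring.
  by apply/seteqP; split => a /=; rewrite E.
apply: prob_pos_le_expR.
  by apply: measurable_funD => //; exact: measurable_funM.
under eq_integral do rewrite /f addrC expRD EFinM.
rewrite ge0_integralZl//; last first.
  by apply/measurable_EFinP; apply: measurableT_comp => //; exact: measurable_funM.
apply: (@le_trans _ _ ((expR K)%:E * (expR (sg * s * (n%:R * tau) +
  18 * (n%:R * ((sg * s) ^+ 2 / (eta * D ^+ 3))) + 1 / 10))%:E)%E).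
  apply: lee_wpmul2l; first by rewrite lee_fin expR_ge0.
  exact: (square_sum_mgf eta0 D0 process).
rewrite -EFinM -expRD lee_fin ler_expR le_eqVlt; apply/orP; left; apply/eqP.
rewrite exprMn sg2 /K /s; field.
by rewrite !gt_eqF.
Qed.

(** Both sides of the inequality that defines the event are homogeneous of degree
  two in [u]. *)
Lemma square_sum_dev u n sg eps : `|sg| = 1 -> 0 < eps -> D * eps <= 9 / 25 ->
  (P [set a | n%:R * eps * dotv u u <
       sg * (square_sum x u n a - n%:R * dotv u (Q *m u))]%R <=
   (expR (1 / 10 - n%:R * (eta * D ^+ 3 * eps ^+ 2) / 72))%:E)%E.
Proof.
move=> sg1 eps0 Deps; have [u0|u0] := eqVneq u 0.
  rewrite (_ : [set _ | _] = set0) ?measure0 ?lee_fin ?expR_ge0//.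
  apply/seteqP; split => // a /=; rewrite u0 !dotv0l mulr0.
  by rewrite /square_sum big1 => [|i _]; rewrite ?dotv0l ?expr0n// !(mulr0, subr0) ltxx.
have uu := dotv_gt0 u0; set m := dotv u u in uu *.
have sm0 : Num.sqrt m != 0 by rewrite gt_eqF// sqrtr_gt0.
have mm : Num.sqrt m ^+ 2 = m by rewrite sqr_sqrtr// ltW.
pose v := (Num.sqrt m)^-1 *: u.
have uE : u = Num.sqrt m *: v by rewrite scalerA divff// scale1r.
have v1 : dotv v v = 1.
  by rewrite /v dotvZl dotvZr -/m -{3}mm; field.
have SE a : square_sum x u n a = m * square_sum x v n a.
  rewrite /square_sum mulr_sumr; apply: eq_bigr => i _.
  by rewrite {1}uE dotvZl exprMn mm.
have QE : dotv u (Q *m u) = m * dotv v (Q *m v).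
  by rewrite {1 2}uE -scalemxAr dotvZl dotvZr mulrA -expr2 mm.
apply: le_trans (square_sum_dev_unit n v1 sg1 eps0 Deps).
rewrite le_eqVlt; apply/orP; left; apply/eqP; congr (P _).
apply/seteqP; split => a /=; rewrite SE QE.
  have -> : sg * (m * square_sum x v n a - n%:R * (m * dotv v (Q *m v))) =
    (sg * (square_sum x v n a - n%:R * dotv v (Q *m v))) * m by ring.
  by rewrite ltr_pM2r.
have -> : sg * (m * square_sum x v n a - n%:R * (m * dotv v (Q *m v))) =
  (sg * (square_sum x v n a - n%:R * dotv v (Q *m v))) * m by ring.
by rewrite ltr_pM2r.
Qed.

Definition noise_correlation (r j : 'I_p) (n : nat) (a : T) : R :=
  \sum_(t < n) w t.+1 a r 0 * x t a j 0.

Lemma measurable_noise_correlation_past r j n :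
  measurable_fun setT (noise_correlation r j n : pastT n -> R).
Proof.
apply: measurable_sum => t; apply: measurable_funM.
  by apply: (measurable_driver_past (s := t.+1)).
by apply: (measurable_state_past process); exact: ltnW.
Qed.

(** The exponential martingale of the noise, with the compensator given by the
  conditional variance. *)
Lemma noise_correlation_mgf r j theta n :
  (\int[P]_a (expR (theta * noise_correlation r j n a -
      theta ^+ 2 * eta / 2 * square_sum x (delta_mx j 0) n a))%:E <= 1)%E.
Proof.
pose e : 'cV[R]_p := delta_mx j 0.
elim: n => [|n IHn].
  under eq_integral do rewrite /noise_correlation /square_sum !big_ord0 !mulr0 subr0 expR0.
  by rewrite integral_cst//= probability_setT mule1.
pose U a := expR (theta * noise_correlation r j n a -
  theta ^+ 2 * eta / 2 * square_sum x e n a).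
have mU : measurable_fun setT (U : pastT n -> R).
  apply: measurableT_comp => //; apply: measurable_funB; apply: measurable_funM => //.
    exact: measurable_noise_correlation_past.
  exact: (measurable_square_sum_past process).
have mxj : measurable_fun setT (fun a : pastT n => x n a j 0).
  exact: (measurable_state_past process).
pose phi a b := U a * expR (- (theta ^+ 2 * eta / 2 * x n a j 0 ^+ 2)) *
  expR (theta * x n a j 0 * w n.+1 b r 0).
apply: le_trans IHn.
have -> : (\int[P]_a (expR (theta * noise_correlation r j n.+1 a -
      theta ^+ 2 * eta / 2 * square_sum x e n.+1 a))%:E = \int[P]_a (phi a a)%:E)%E.
  apply: eq_integral => a _; congr EFin; rewrite /phi /U -!expRD; congr expR.
  rewrite /noise_correlation /square_sum !big_ord_recr /= dotv_delta; ring.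
have mV : measurable_fun setT (fun a : pastT n =>
    U a * expR (- (theta ^+ 2 * eta / 2 * x n a j 0 ^+ 2))).
  apply: measurable_funM => //; apply: measurableT_comp => //; apply: measurableT_comp => //.
  by apply: measurable_funM => //; exact: measurable_funX.
apply: (freeze_past_le process (t := n)) => //.
- apply: measurable_funM; first exact: (measurable_past_pair mV).
  apply: measurableT_comp => //; apply: measurable_funM; last exact: measurable_noise_pair.
  apply: (@measurable_past_pair _ _ _ _ _ _ _ (fun a => theta * x n a j 0)).
  exact: measurable_funM.
- by move=> a b; rewrite !mulr_ge0 ?expR_ge0.
- move=> a; rewrite /phi; set c := U a * _; set b := theta * x n a j 0.
  under eq_integral do rewrite EFinM.
  have mw : measurable_fun setT (fun b' => w n.+1 b' r 0).
    exact: (measurable_driver process n.+1).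
  rewrite ge0_integralZl//; last 2 first.
  + by apply/measurable_EFinP; apply: measurableT_comp => //; exact: measurable_funM.
  + by rewrite lee_fin mulr_ge0 ?expR_ge0.
  have -> : (\int[P]_y (expR (b * w n.+1 y r 0))%:E = (expR (theta ^+ 2 * eta / 2 * x n a j 0 ^+ 2))%:E)%E.
    have := gaussian_vector_expR_dotv (noise_gaussian process n) (b *: delta_mx r 0).
    rewrite dotv_isotropic dotvZl dotvZr dotv_delta2 mulr1.
    under eq_integral do rewrite dotvZl dotv_delta.
    by move=> ->; congr (expR _)%:E; rewrite /b; field.
  by rewrite -EFinM /c expRN divfK// gt_eqF// expR_gt0.
Qed.

Lemma measurable_noise_correlation r j n :
  measurable_fun setT (noise_correlation r j n).
Proof.
exact: (measurable_past_fun process (@measurable_noise_correlation_past r j n)).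
Qed.

Lemma measurable_noise_correlation_event r j n sg g V :
  measurable [set a | g < sg * noise_correlation r j n a /\
                      square_sum x (delta_mx j 0) n a <= V].
Proof.
have mS := measurable_square_sum process (delta_mx j 0) n.
have mC := @measurable_noise_correlation r j n.
rewrite (_ : [set a | _] = [set a | 0 < sg * noise_correlation r j n a - g] `&`
    ~` [set a | 0 < square_sum x (delta_mx j 0) n a - V]); last first.
  apply/seteqP; split => a /=; rewrite !subr_gt0 => -[h1 h2]; split => //.
    by apply/negP; rewrite -leNgt.
  by move/negP: h2; rewrite -leNgt.
apply: measurableI; last apply: measurableC.
  by apply: measurable_pos; apply: measurable_funB => //; exact: measurable_funM.
by apply: measurable_pos; exact: measurable_funB.
Qed.

(** On this event the compensator of the exponential martingale is bounded by its
  value at [V], and Markov's inequality applies. *)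
Lemma noise_correlation_tail r j n sg g V : `|sg| = 1 -> 0 < g -> 0 < V ->
  (P [set a | g < sg * noise_correlation r j n a /\
              square_sum x (delta_mx j 0) n a <= V]%R <=
   (expR (- (g ^+ 2 / (2 * eta * V))))%:E)%E.
Proof.
move=> sg1 g0 V0.
have sg2 : sg ^+ 2 = 1 by rewrite -real_normK ?num_real// sg1 expr1n.
(* The minimizer of [th ^+ 2 * eta / 2 * V - th * g]. *)
pose th := g / (eta * V); have th0 : 0 < th by rewrite divr_gt0// mulr_gt0.
have mS := measurable_square_sum process (delta_mx j 0) n.
have mC := @measurable_noise_correlation r j n.
pose f a := sg * th * noise_correlation r j n a -
  (sg * th) ^+ 2 * eta / 2 * square_sum x (delta_mx j 0) n a.
have mf : measurable_fun setT f.
  by apply: measurable_funB; apply: measurable_funM.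
pose K := - (g ^+ 2 / (2 * eta * V)).
have sub : [set a | g < sg * noise_correlation r j n a /\
    square_sum x (delta_mx j 0) n a <= V] `<=` [set a | 0 < K + f a].
  move=> a /= [ga SV]; rewrite /f exprMn sg2 mul1r.
  have h1 : th * g < th * (sg * noise_correlation r j n a) by rewrite ltr_pM2l.
  have h2 : th ^+ 2 * eta / 2 * square_sum x (delta_mx j 0) n a <= th ^+ 2 * eta / 2 * V.
    apply: ler_wpM2l => //; apply: divr_ge0 => //.
    by apply: mulr_ge0 (ltW eta0); exact: sqr_ge0.
  have -> : sg * th * noise_correlation r j n a = th * (sg * noise_correlation r j n a) by ring.
  have : K + (th * g - th ^+ 2 * eta / 2 * V) = 0.
    by rewrite /K /th; field; rewrite !gt_eqF.
  lra.
have mKf : measurable_fun setT (fun a => K + f a) by exact: measurable_funD.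
have mA := @measurable_noise_correlation_event r j n sg g V.
apply: (@le_trans _ _ (P [set a | 0 < K + f a]%R)).
  by apply: le_measure; rewrite ?inE//; exact: measurable_pos.
apply: prob_pos_le_expR => //.
under eq_integral do rewrite expRD EFinM.
rewrite ge0_integralZl//; last first.
  by apply/measurable_EFinP; exact: measurableT_comp.
rewrite -[leRHS]mule1; apply: lee_wpmul2l; first by rewrite lee_fin expR_ge0.
exact: noise_correlation_mgf.
Qed.

End Tails.

(** * Recovery on the good event *)

Section GoodTrajectory.
Context {R : realType}.

Lemma lambda_min_dim0 m (M : 'M[R]_m) : m = 0%N -> lambda_min M = 0.
Proof.
move=> m0; rewrite /lambda_min (_ : spectrum M = set0) ?inf0//.
apply/seteqP; split => // a /= /eigenvalueP[v _ /eqP]; case.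
by apply/rowP => i; have := ltn_ord i; rewrite [X in (_ < X)%N]m0.
Qed.

Lemma Cmin_le_diag p (Q : 'M[R]_p) (S : {set 'I_p}) i : Q^T = Q -> i \in S ->
  Cmin Q S <= Q i i.
Proof.
move=> Qsym iS; have QSsym : (submatrix Q S S)^T = submatrix Q S S.
  by apply/matrixP => a b; rewrite !mxE -[in LHS]Qsym mxE.
have := lambda_min_le (delta_mx (enum_rank_in iS i) 0) QSsym.
by rewrite dotv_delta2 mulr1 dotv_delta -colE !mxE enum_rankK_in.
Qed.

Lemma min_abs_nonzero_le p (v : 'cV[R]_p) i : v i 0 != 0 ->
  min_abs_nonzero v <= `|v i 0|.
Proof.
move=> vi; apply: ge_inf; last by exists i.
by exists 0 => _ [j _ <-].
Qed.

Lemma min_abs_nonzero_gt0 p (v : 'cV[R]_p) i : v i 0 != 0 ->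
  0 < min_abs_nonzero v.
Proof.
move=> vi; have [j vj jmin] := @arg_minP _ _ _ i (fun i => v i 0 != 0) (fun i => `|v i 0|) vi.
apply: (@lt_le_trans _ _ `|v j 0|); first by rewrite normr_gt0.
apply: lb_le_inf; first by exists `|v i 0|, i.
by move=> _ [l /= vl <-]; exact: jmin.
Qed.

(** Polarization: the products of coordinates are controlled by the squares of the
  sums and differences of two coordinates, in the proportion given by the
  parallelogram law. *)
Lemma polarized_deviation p n (y : nat -> 'cV[R]_p) (Q : 'M[R]_p) eps i j :
  (0 < n)%N -> Q^T = Q ->
  let S u := \sum_(t < n) dotv u (y t) ^+ 2 in
  (forall b : bool, let u := delta_mx i 0 + (-1) ^+ b *: delta_mx j 0 in
    `|S u - n%:R * dotv u (Q *m u)| <= n%:R * eps * dotv u u) ->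
  `|empirical_covariance n y i j - Q i j| <= eps.
Proof.
move=> n0 Qsym S dev; have n1 : 0 < n%:R :> R by rewrite ltr0n.
pose ei : 'cV[R]_p := delta_mx i 0; pose ej : 'cV[R]_p := delta_mx j 0.
have := dev true; have := dev false; rewrite expr0 expr1 scale1r scaleN1r -/ei -/ej /=.
set Sp := S (ei + ej); set Sm := S (ei - ej).
have SS : Sp - Sm = 4 * (n%:R * empirical_covariance n y i j).
  rewrite empirical_covarianceE mulVKf ?gt_eqF// big_mkord.
  rewrite mulr_sumr -sumrB; apply: eq_bigr => t _.
  by rewrite dotvDl dotvBl !dotv_delta; ring.
have Qij : dotv ei (Q *m ej) = Q i j by rewrite dotv_delta -colE mxE.
have Qji : dotv ej (Q *m ei) = Q i j.
  by rewrite dotv_delta -colE mxE -[in LHS]Qsym mxE.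
rewrite !(mulmxDr, mulmxN, dotvDl, dotvDr, dotvNl, dotvNr) Qij Qji !dotv_delta2.
rewrite [dotv ej ei]dotvC; set qi := dotv ei (Q *m ei); set qj := dotv ej (Q *m ej).
set d := dotv ei ej.
move=> dp dm.
suff nH : n%:R * `|empirical_covariance n y i j - Q i j| <= n%:R * eps.
  by rewrite -(ler_pM2l n1).
move: dp dm; rewrite !ler_norml => /andP[p1 p2] /andP[m1 m2].
rewrite -[X in X * _](gtr0_norm n1) -normrM mulrBr ler_norml.
move: SS; set H := n%:R * empirical_covariance n y i j.
move: p1 p2 m1 m2; rewrite ?mulrDr ?mulrN ?mulr1 ?opprK.
set nq := n%:R * Q i j; set ni := n%:R * qi; set nj := n%:R * qj.
set ne := n%:R * eps; set ned := ne * d.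
by move=> p1 p2 m1 m2 SS; apply/andP; split; lra.
Qed.

(** The interface with the probabilistic part: recovery along a fixed trajectory
  whose quadratic sums and noise correlations are under control. *)
Lemma good_trajectory_recovers p n (eta : R) (A Q : 'M[R]_p) (r : 'I_p)
    (y v : nat -> 'cV[R]_p) (k : nat) (lam eps : R) :
  let a0 := drift_row A r in let S := supp a0 in
  let C := Cmin Q S in let alpha := incoherence Q S in
  let Sq u := \sum_(t < n) dotv u (y t) ^+ 2 in
  0 < eta -> (0 < n)%N -> Q^T = Q ->
  (forall t, y t.+1 = y t + eta *: (A *m y t) + v t.+1) ->
  (#|S| <= k)%N -> 0 < C -> 0 < alpha -> 0 < lam -> 0 <= eps ->
  7 * (k%:R * eps) <= alpha * C ->
  14 / 9 * k%:R * lam < C * min_abs_nonzero a0 ->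
  (forall i j (b : bool), j \in S ->
    let u := delta_mx i 0 + (-1) ^+ b *: delta_mx j 0 in
    `|Sq u - n%:R * dotv u (Q *m u)| <= n%:R * eps * dotv u u) ->
  (forall i, `|\sum_(t < n) v t.+1 r 0 * y t i 0| <=
    n%:R * eta * (lam * alpha / 3)) ->
  recovers_signed_support eta n y r lam a0.
Proof.
move=> a0 S C alpha Sq eta0 n0 Qsym yS Sk C0 alpha0 lam0 eps0 keps kl dev corr.
have n1 : 0 < n%:R :> R by rewrite ltr0n.
pose e t := y t.+1 r 0 - y t r 0 - eta * dotv a0 (y t).
have eE t : e t = v t.+1 r 0.
  rewrite /e yS !mxE (_ : \sum_j _ = dotv a0 (y t)).
    by ring.
  by rewrite dotvE; apply: eq_bigr => j _; rewrite !mxE.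
pose H := empirical_covariance n y.
pose G := (n%:R * eta)^-1 *: \sum_(0 <= t < n) e t *: y t.
pose c := (2 * eta ^+ 2 * n%:R)^-1 * \sum_(0 <= t < n) e t ^+ 2.
have costE : lasso_cost eta n y r lam = quadratic_lasso H G a0 lam c.
  by apply/funext => b; rewrite (lasso_cost_quadratic _ _ _ a0)// gt_eqF.
have Hpos b : 0 <= dotv b (H *m b).
  rewrite empirical_covariance_form mulr_ge0 ?invr_ge0//.
  by apply: sumr_ge0 => t _; exact: sqr_ge0.
have GE i : G i 0 = (n%:R * eta)^-1 * \sum_(t < n) v t.+1 r 0 * y t i 0.
  rewrite mxE summxE big_mkord; congr (_ * _); apply: eq_bigr => t _.
  by rewrite mxE eE.
have ne0 : 0 < n%:R * eta by rewrite mulr_gt0.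
have Gle i : `|G i 0| <= lam * alpha / 3.
  rewrite GE normrM normfV (gtr0_norm ne0) mulrC ler_pdivrMr// mulrC.
  exact: corr.
have HQ i j : j \in S -> `|H i j - Q i j| <= eps.
  by move=> jS; apply: polarized_deviation => // b; exact: dev.
have amin i : i \in S -> 14 / 9 * k%:R * lam < C * `|a0 i 0|.
  rewrite inE => ai; apply: lt_le_trans kl _.
  by rewrite ler_wpM2l ?(ltW C0)// min_abs_nonzero_le.
have [b [bmin bsign]] := @lasso_sign_consistency _ _ Q H G a0 lam c eps k Qsym
  (empirical_covariance_sym n y) Hpos Sk C0 alpha0 lam0 eps0 keps HQ Gle amin.
by exists b; split => //; rewrite -bmin /lasso_solutions costE.
Qed.

End GoodTrajectory.

Section UnionBound.
Context {d : measure_display} {T : measurableType d} {R : realType}.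
Variable P : probability T R.

Lemma union_bound (I : finType) (B : I -> set T) (b : R) :
  (forall i, measurable (B i)) -> (forall i, P (B i) <= b%:E)%E ->
  exists U, [/\ measurable U, forall i, B i `<=` U & (P U <= (#|I|%:R * b)%:E)%E].
Proof.
move=> mB PB.
suff [U [mU BU PU]] : exists U, [/\ measurable U,
    forall i, i \in enum I -> B i `<=` U & (P U <= ((size (enum I))%:R * b)%:E)%E].
  exists U; split => //; last by rewrite cardE.
  by move=> i; apply: BU; rewrite mem_enum.
elim: (enum I) => [|i s [U [mU BU PU]]].
  by exists set0; rewrite measure0 mul0r.
exists (B i `|` U); split.
- exact: measurableU.
- move=> j; rewrite inE => /predU1P[->|js]; first exact: subsetUl.
  by apply: subset_trans (BU j js) _; exact: subsetUr.
- apply: le_trans (measureU2 _ _ _) _ => //=.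
  by rewrite -[(size s).+1]add1n natrD mulrDl mul1r EFinD leeD.
Qed.

End UnionBound.

(** * Sample size and conclusion *)

Section SampleSize.
Context {R : realType}.

(** The two terms of the sum in the sample size have separate purposes: the one
  with [D] gives the concentration of the covariance at scale [al * C / (7 * K)],
  where [10 ^+ 4 / 49] is rounded to [200], and the one with [Am] keeps the
  regularization below the signal. *)
Lemma sample_size_bounds (X D C al Am K L L1 : R) :
  0 < D -> 0 < C -> 0 < al -> 0 < Am -> 1 <= K -> 0 < L1 -> L1 <= L ->
  (10 ^+ 4 * K ^+ 2 * (K * D ^- 2 + Am ^- 2)) / (al ^+ 2 * D * C ^+ 2) * L < X ->
  [/\ 0 < X, 200 * L <= X * D ^+ 3 * (al * C / (7 * K)) ^+ 2 &
    14 / 9 * K * Num.sqrt (36 * L1 / (D * al ^+ 2 * X)) < C * Am].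
Proof.
move=> D0 C0 al0 Am0 K1 L10 L1L.
have K0 : 0 < K by lra.
have L0 : 0 < L by lra.
have den0 : 0 < al ^+ 2 * D * C ^+ 2 by rewrite !mulr_gt0 ?exprn_gt0.
rewrite mulrAC ltr_pdivrMr// => hX.
have D2 : 0 < D ^- 2 by rewrite invr_gt0 exprn_gt0.
have Am2 : 0 < Am ^- 2 by rewrite invr_gt0 exprn_gt0.
have K2 : 0 < 10 ^+ 4 * K ^+ 2 :> R by rewrite mulr_gt0 ?exprn_gt0.
have hX1 : 10 ^+ 4 * K ^+ 2 * (K * D ^- 2) * L < X * (al ^+ 2 * D * C ^+ 2).
  apply: le_lt_trans hX; rewrite ler_pM2r// ler_pM2l// lerDl ltW//.
have hX2 : 10 ^+ 4 * K ^+ 2 * Am ^- 2 * L < X * (al ^+ 2 * D * C ^+ 2).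
  apply: le_lt_trans hX; rewrite ler_pM2r// ler_pM2l// lerDr ltW//.
  by rewrite mulr_gt0.
have X0 : 0 < X.
  rewrite -(pmulr_lgt0 _ den0); apply: le_lt_trans hX1.
  by rewrite !mulr_ge0// ltW.
split=> //.
  have e1 : 10 ^+ 4 * K * L / 49 = 10 ^+ 4 * K ^+ 2 * (K * D ^- 2) * L * (D ^+ 2 / (49 * K ^+ 2)).
    by field; rewrite !gt_eqF.
  have e2 : X * D ^+ 3 * (al * C / (7 * K)) ^+ 2 =
      X * (al ^+ 2 * D * C ^+ 2) * (D ^+ 2 / (49 * K ^+ 2)).
    by field; rewrite !gt_eqF.
  rewrite e2; apply: (@le_trans _ _ (10 ^+ 4 * K * L / 49)).
    have -> : 10 ^+ 4 * K * L / 49 = 10 ^+ 4 / 49 * (K * L) by field.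
    have : L <= K * L by rewrite ler_peMl// ltW.
    set KL := K * L; have -> : 10 ^+ 4 / 49 = 10000 / 49 :> R by field.
    lra.
  rewrite e1 ltW// ltr_pM2r// divr_gt0 ?exprn_gt0//.
  by rewrite mulr_gt0 ?exprn_gt0.
have den1 : 0 < D * al ^+ 2 * X by rewrite !mulr_gt0 ?exprn_gt0.
have q0 : 0 <= 36 * L1 / (D * al ^+ 2 * X) by rewrite divr_ge0 ?mulr_ge0// ltW.
rewrite -(@ltr_pXn2r _ 2)// ?nnegrE; last 2 first.
- by rewrite !mulr_ge0 ?sqrtr_ge0// ltW.
- by apply: mulr_ge0; exact: ltW.
rewrite exprMn sqr_sqrtr// mulrA ltr_pdivrMr//.
have hX3 : 10 ^+ 4 * K ^+ 2 * L < X * (al ^+ 2 * D * C ^+ 2) * Am ^+ 2.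
  rewrite -ltr_pdivrMr ?exprn_gt0//; apply: le_lt_trans hX2.
  by rewrite le_eqVlt; apply/orP; left; apply/eqP; field; rewrite gt_eqF.
have -> : (C * Am) ^+ 2 * (D * al ^+ 2 * X) = X * (al ^+ 2 * D * C ^+ 2) * Am ^+ 2 by ring.
apply: le_lt_trans hX3.
have -> : (14 / 9 * K) ^+ 2 * (36 * L1) = 784 / 9 * (K ^+ 2 * L1) by field.
have -> : 10 ^+ 4 * K ^+ 2 * L = 10000 * (K ^+ 2 * L) by ring.
have : K ^+ 2 * L1 <= K ^+ 2 * L by rewrite ler_pM2l// exprn_gt0.
have : 0 <= K ^+ 2 * L1 by rewrite mulr_ge0 ?exprn_ge0// ltW.
by set a := K ^+ 2 * L1; set b := K ^+ 2 * L; lra.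
Qed.

(** The constant [36] in the regularization is the one that makes the exponent of
  [noise_correlation_tail] equal to [L1], for the level [lam * al / 3] of the
  gradient and twice the a priori bound [N / D] on the sum of the squares. *)
Lemma gradient_exponent (N eta lam al D L1 : R) :
  0 < N -> 0 < eta -> 0 < al -> 0 < D ->
  lam ^+ 2 = 36 * L1 / (D * al ^+ 2 * (N * eta)) ->
  (N * eta * (lam * al / 3)) ^+ 2 / (2 * eta * (2 * N / D)) = L1.
Proof.
move=> N0 eta0 al0 D0 lam2.
have -> : (N * eta * (lam * al / 3)) ^+ 2 = lam ^+ 2 * (N * eta * al / 3) ^+ 2.
  by field.
by rewrite lam2; field; rewrite !gt_eqF.
Qed.

(** The quadratic events cost at most [5 p k] times the square of
  [delta / (4 p k)], which is below [delta / 2]. *)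
Lemma failure_budget (p k s delta t : R) : 1 <= p -> 1 <= k -> 0 <= s -> s <= k ->
  0 < delta -> delta < 1 -> 0 <= t -> t <= (delta / (4 * p * k)) ^+ 2 ->
  p * s * 2 * 2 * t + p * t + p * 2 * (delta / (4 * p)) < delta.
Proof.
move=> p1 k1 s0 sk d0 d1 t0 tle.
have p0 : 0 < p by lra.
have k0 : 0 < k by lra.
have pk1 : 1 <= p * k by rewrite mulr_ege1.
have -> : p * 2 * (delta / (4 * p)) = delta / 2 by field; rewrite gt_eqF.
set q := delta / (4 * p * k) in tle *.
have qE : p * k * q = delta / 4 by rewrite /q; field; rewrite !gt_eqF.
have q0 : 0 <= q by rewrite /q divr_ge0 ?mulr_ge0// ltW.
have q4 : q <= 1 / 4.
  have : 1 * q <= p * k * q by rewrite ler_wpM2r.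
  by rewrite qE mul1r; lra.
have h1 : p * s * t <= p * k * t by rewrite ler_wpM2r// ler_wpM2l// ltW.
have h2 : p * t <= p * k * t by rewrite ler_wpM2r// ler_peMr// ltW.
have h3 : p * k * t <= p * k * (q * q) by rewrite ler_wpM2l// ltW// mulr_gt0.
have h4 : p * k * (q * q) <= delta / 4 * (1 / 4).
  by rewrite mulrA qE ler_wpM2l//; lra.
have -> : p * s * 2 * 2 * t = 4 * (p * s * t) by ring.
lra.
Qed.

Lemma ln4_ge : 3 / 4 <= ln 4 :> R.
Proof.
rewrite -ler_expR lnK ?posrE// -lef_pV2 ?posrE ?expR_gt0// -expRN.
by apply: le_trans (expR_ge1Dx _); lra.
Qed.

Lemma norm_le_signs (z c : R) : (forall b : bool, (-1) ^+ b * z <= c) -> `|z| <= c.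
Proof.
move=> h; have := h true; have := h false; rewrite expr0 expr1 mul1r mulN1r.
by move=> h1 h2; rewrite ler_norml; apply/andP; split; lra.
Qed.

Lemma norm_sign (b : bool) : `|(-1) ^+ b| = 1 :> R.
Proof. by rewrite normrX normrN1 expr1n. Qed.

End SampleSize.

Theorem theorem3p1 (R : realType) (d : measure_display)
    (Omega : measurableType d) (P : probability Omega R)
    (p : nat) (r : 'I_p) (eta : R) (A0 Q0 : 'M[R]_p)
    (x w : nat -> Omega -> 'cV[R]_p) (k n : nat) (delta : R) :
  let A0r := drift_row A0 r in
  let S0 := supp A0r in
  let Amin := min_abs_nonzero A0r in
  let D := contraction_rate eta A0 in
  let C := Cmin Q0 S0 in
  let alpha := incoherence Q0 S0 in
  0 < eta ->
  stationary_process P eta A0 Q0 x w ->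
  (#|S0| <= k)%N ->
  0 < C ->
  0 < alpha ->
  0 < D ->
  0 < delta < 1 ->
  (10 ^+ 4 * k%:R ^+ 2 * (k%:R * D ^- 2 + Amin ^- 2))
    / (alpha ^+ 2 * D * C ^+ 2) * ln (4 * p%:R * k%:R / delta) < n%:R * eta ->
  exists lambda : R,
    lambda = Num.sqrt (36 * ln (4 * p%:R / delta)
                         / (D * alpha ^+ 2 * (n%:R * eta))) /\
    probability_larger_than P
      [set omega | recovers_signed_support eta n (fun t => x t omega) r
                     lambda A0r]
      (1 - delta).
Proof.
move=> A0r S0 Amin D C alpha eta0 process Sk C0 alpha0 D0 /andP[del0 del1] hn.
have [_ Qsym Qpos _] := initial_gaussian process.
have Qeq := stationary_covariance process.
have alpha1 : alpha <= 1 by exact: incoherence_le1.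
(* The spectrum of the empty matrix is empty, and the infimum is then [0]. *)
have S_gt0 : (0 < #|S0|)%N.
  rewrite lt0n; apply/eqP => S00.
  by move: C0; rewrite /C /Cmin lambda_min_dim0// ltxx.
have /card_gt0P[i0 i0S] := S_gt0.
have k1 : (1 <= k)%N by exact: leq_trans Sk.
have p1 : (1 <= p)%N by apply: leq_ltn_trans (ltn_ord r).
have K1 : 1 <= k%:R :> R by rewrite ler1n.
have P1 : 1 <= p%:R :> R by rewrite ler1n.
have Amin0 : 0 < Amin by apply: (@min_abs_nonzero_gt0 _ _ _ i0); rewrite inE in i0S.
have D_le (i : 'I_p) : Q0 i i <= D^-1.
  have := covariance_le eta0 D0 Qsym Qpos Qeq (delta_mx i 0).
  by rewrite dotv_delta -colE mxE dotv_delta2 div1r.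
have DC : D * C <= 1.
  have := le_trans (Cmin_le_diag Qsym i0S) (D_le i0).
  by rewrite -/C -(ler_pM2l D0) divff ?gt_eqF.
set L := ln (4 * p%:R * k%:R / delta) in hn *; set L1 := ln (4 * p%:R / delta).
have del1' : 1 <= delta^-1 by rewrite invf_ge1// ltW.
have arg1 : 4 <= 4 * p%:R / delta by nra.
have argk : 4 * p%:R / delta <= 4 * p%:R * k%:R / delta.
  by rewrite ler_pM2r ?invr_gt0// ler_peMr// mulr_ge0.
have L1L : L1 <= L by rewrite ler_ln ?posrE//; lra.
have L1ge : 3 / 4 <= L1 by apply: le_trans ln4_ge _; rewrite ler_ln ?posrE//; lra.
have L10 : 0 < L1 by lra.
have [X0 hconc hlam] := sample_size_bounds D0 C0 alpha0 Amin0 K1 L10 L1L hn.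
set lam := Num.sqrt _ in hlam *.
exists lam; split => //.
have n1 : 0 < n%:R :> R by rewrite -(pmulr_lgt0 _ eta0).
have n0 : (0 < n)%N by rewrite -(ltr0n R).
have K0 : 0 < k%:R :> R by lra.
pose eps := alpha * C / (7 * k%:R).
have eps0 : 0 < eps by rewrite divr_gt0 ?mulr_gt0.
have keps : 7 * (k%:R * eps) = alpha * C by rewrite /eps; field; rewrite gt_eqF.
have Deps : D * eps <= 1 / 7.
  have -> : D * eps = alpha * (D * C) / (7 * k%:R) by rewrite /eps; field; rewrite gt_eqF.
  rewrite ler_pdivrMr ?mulr_gt0//.
  have : alpha * (D * C) <= 1.
    by apply: mulr_ile1 => //; [exact: ltW|apply: mulr_ge0; exact: ltW].
  lra.
have Deps' : D * eps <= 9 / 25 by lra.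
have lam_arg : 0 < 36 * L1 / (D * alpha ^+ 2 * (n%:R * eta)).
  by apply: divr_gt0; apply: mulr_gt0 => //; rewrite mulr_gt0 ?exprn_gt0.
have lam2 : lam ^+ 2 = 36 * L1 / (D * alpha ^+ 2 * (n%:R * eta)).
  by rewrite sqr_sqrtr// ltW.
have lam0 : 0 < lam by rewrite sqrtr_gt0.
pose tail := 1 / 10 - n%:R * (eta * D ^+ 3 * eps ^+ 2) / 72.
have tail_le : expR tail <= (delta / (4 * p%:R * k%:R)) ^+ 2.
  have -> : delta / (4 * p%:R * k%:R) = expR (- L).
    rewrite /L expRN lnK ?posrE; first by rewrite invf_div.
    by rewrite divr_gt0 ?mulr_gt0//; clear - P1; lra.
  rewrite -expRM_natl ler_expR /tail.
  move: hconc; rewrite -/eps.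
  have -> : n%:R * (eta * D ^+ 3 * eps ^+ 2) = n%:R * eta * D ^+ 3 * eps ^+ 2 by ring.
  by set z := _ * eps ^+ 2 => hz; clear - hz L1L L1ge; lra.
pose sq u omega := square_sum x u n omega - n%:R * dotv u (Q0 *m u).
have msq u : measurable_fun setT (sq u).
  by apply: measurable_funB => //; exact: (measurable_square_sum process).
pose uv (z : 'I_p * 'I_#|S0| * bool) : 'cV[R]_p :=
  delta_mx z.1.1 0 + (-1) ^+ z.2 *: delta_mx (enum_val z.1.2) 0.
pose B1 (z : 'I_p * 'I_#|S0| * bool * bool) : set Omega :=
  [set omega | n%:R * eps * dotv (uv z.1) (uv z.1) < (-1) ^+ z.2 * sq (uv z.1) omega].
have mB u sg : measurable [set omega | n%:R * eps * dotv u u < sg * sq u omega].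
  rewrite (_ : [set _ | _] = [set omega | 0 < sg * sq u omega - n%:R * eps * dotv u u]).
    by apply: measurable_pos; apply: measurable_funB => //; exact: measurable_funM.
  by apply/seteqP; split => omega /=; rewrite subr_gt0.
have [|z|U1 [mU1 BU1 PU1]] := @union_bound _ _ _ P _ B1 (expR tail).
- by move=> z; exact: mB.
- exact: (square_sum_dev eta0 D0 process _ _ (norm_sign _) eps0 Deps').
(* These events bound the compensators of the gradient at all coordinates, in the
   support or not. *)
pose B2 (i : 'I_p) : set Omega :=
  [set omega | n%:R * eps * dotv (delta_mx i 0) (delta_mx i 0) < 1 * sq (delta_mx i 0) omega].
have [|i|U2 [mU2 BU2 PU2]] := @union_bound _ _ _ P _ B2 (expR tail).
- by move=> i; exact: mB.
- exact: (square_sum_dev eta0 D0 process _ _ (normr1 _) eps0 Deps').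
pose V := 2 * n%:R / D; have V0 : 0 < V by apply: divr_gt0 => //; exact: mulr_gt0.
pose g := n%:R * eta * (lam * alpha / 3).
have g0 : 0 < g by rewrite mulr_gt0// divr_gt0// mulr_gt0.
pose B3 (z : 'I_p * bool) : set Omega :=
  [set omega | g < (-1) ^+ z.2 * noise_correlation x w r z.1 n omega /\
     square_sum x (delta_mx z.1 0) n omega <= V].
have [|z|U3 [mU3 BU3 PU3]] := @union_bound _ _ _ P _ B3 (delta / (4 * p%:R)).
- by move=> z; exact: (measurable_noise_correlation_event process).
- apply: le_trans (noise_correlation_tail eta0 process r z.1 n (norm_sign _) g0 V0) _.
  have -> : g ^+ 2 / (2 * eta * V) = L1.
    exact: gradient_exponent.
  by rewrite expRN lnK ?posrE ?invf_div//; clear - arg1; lra.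
exists (~` (U1 `|` U2 `|` U3)).
have mU : measurable (U1 `|` U2 `|` U3).
  by apply: measurableU => //; exact: measurableU.
split; first exact: measurableC.
- move=> omega /= Uomega.
  have nB1 z : ~ B1 z omega by move=> Bz; apply: Uomega; left; left; exact: (BU1 z).
  have nB2 i : ~ B2 i omega by move=> Bi; apply: Uomega; left; right; exact: (BU2 i).
  have nB3 z : ~ B3 z omega by move=> Bz; apply: Uomega; right; exact: (BU3 z).
  apply: (@good_trajectory_recovers _ p n eta A0 Q0 r (fun t => x t omega)
    (fun t => w t omega) k lam eps) => //.
  + by move=> t; rewrite (recursion process).
  + exact: ltW.
  + by rewrite keps.
  + move=> i j b jS; apply: norm_le_signs => sg; rewrite leNgt; apply/negP.
    by have := nB1 (i, enum_rank_in jS j, b, sg); rewrite /B1 /uv /= enum_rankK_in.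
  + move=> i; apply: norm_le_signs => sg; rewrite leNgt; apply/negP => gi.
    apply: (nB3 (i, sg)); split => //=.
    have := nB2 i; rewrite /B2 /= dotv_delta2 mulr1 mul1r => /negP.
    rewrite -leNgt /sq dotv_delta -colE mxE lerBlDr => /le_trans; apply.
    have Qii := D_le i; rewrite -mulrDr (_ : V = n%:R * (2 * D^-1)); last first.
      by rewrite /V [2 * _]mulrC mulrA.
    rewrite ler_pM2l//.
    have : eps <= D^-1.
      by rewrite -(ler_pM2l D0) divff ?gt_eqF//; clear - Deps; lra.
    by move=> epsD; clear - Qii epsD; lra.
- have fin : P (U1 `|` U2 `|` U3) \is a fin_num by exact: fin_num_measure.
  have : (P (U1 `|` U2 `|` U3) <= (#|{: 'I_p * 'I_#|S0| * bool * bool}|%:R * expR tail +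
     #|'I_p|%:R * expR tail + #|{: 'I_p * bool}|%:R * (delta / (4 * p%:R)))%:E)%E.
    apply: le_trans (measureU2 _ (measurableU _ _ mU1 mU2) mU3) _.
    rewrite !EFinD; apply: leeD => //.
    by apply: le_trans (measureU2 _ mU1 mU2) _; exact: leeD.
  rewrite probability_setC// -(fineK fin) -EFinB lee_fin lte_fin.
  rewrite !card_prod !card_ord card_bool !natrM.
  have Sk' : #|S0|%:R <= k%:R :> R by rewrite ler_nat.
  have := failure_budget P1 K1 (ler0n R #|S0|) Sk' del0 del1 (expR_ge0 tail) tail_le.
  by move=> budget PU; clear - budget PU; lra.
Qed.
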